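(* Let $K$ be any field and $n\ge 6$ an integer. Let $I_n(K)$ be the kernel of the $K$-algebra homomorphism $K[y_{ij}\mid 1\le j<i\le n]\to K[s_1,\dots,s_n,t_1,\dots,t_n]$ determined by $y_{ij}\mapsto s_is_j+t_it_j$. Then $I_n(K)$ is generated, as an ideal, by the orbits of the pentad $P$ and of the off-diagonal minor $M$ under the symmetric group $\operatorname{Sym}(n)$.
   Context: Identify $y_{ji}$ with $y_{ij}$ for $j<i$. The pentad $P$ is the polynomial with integer coefficients $P=\frac{1}{10}\sum_{\pi\in\operatorname{Sym}(5)}\operatorname{sgn}(\pi)\,y_{\pi(1)\pi(2)}y_{\pi(2)\pi(3)}y_{\pi(3)\pi(4)}y_{\pi(4)\pi(5)}y_{\pi(5)\pi(1)}$ (each monomial occurs 10 times, so all coefficients of $P$ are $\pm1$), regarded in $K$ via $\mathbb{Z}\to K$. The off-diagonal minor $M$ is the determinant of the $3\times 3$ matrix $(y_{ij})_{i\in\{4,5,6\},\,j\in\{1,2,3\}}$. $\operatorname{Sym}(n)$ acts by $\sigma y_{ij}=y_{\sigma(i)\sigma(j)}$ (using the identification $y_{ji}=y_{ij}$). *)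

(* Defs.v *)
From HB Require Import structures.
From mathcomp Require Import all_boot all_order all_algebra all_fingroup.
From mathcomp Require Import mpoly.
Set Implicit Arguments. Unset Strict Implicit. Unset Printing Implicit Defensive.
Import GRing.Theory.
Local Open Scope ring_scope.

Definition pairs (n : nat) := {p : 'I_n * 'I_n | (p.2 < p.1)%N}.
Definition nvars (n : nat) : nat := #|{: pairs n}|.

Definition yvar (R : nzRingType) (n : nat) (p : pairs n) : {mpoly R[nvars n]} :=
  'X_(enum_rank p).

(* y_ij for arbitrary i, j, with the identification y_ji = y_ij
   (y_ii is never used; it is set to 0). *)
Definition yy (R : nzRingType) (n : nat) (i j : 'I_n) : {mpoly R[nvars n]} :=
  match (insub (i, j) : option (pairs n)) with
  | Some p => yvar R p
  | None => match (insub (j, i) : option (pairs n)) with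
            | Some p => yvar R p
            | None => 0
            end
  end.

Definition ynat (R : nzRingType) (n : nat) (i j : nat) : {mpoly R[nvars n]} :=
  match (insub i : option 'I_n), (insub j : option 'I_n) with
  | Some a, Some b => yy R a b
  | _, _ => 0
  end.

Definition svar (K : fieldType) (n : nat) (i : 'I_n) : {mpoly K[n + n]} := 'X_(lshift n i).
Definition tvar (K : fieldType) (n : nat) (i : 'I_n) : {mpoly K[n + n]} := 'X_(rshift n i).

Definition phi (K : fieldType) (n : nat) (p : {mpoly K[nvars n]}) : {mpoly K[n + n]} :=
  comp_mpoly [tuple (let q := val (enum_val k) in
                     svar K q.1 * svar K q.2 + tvar K q.1 * tvar K q.2)
             | k < nvars n] p.

Definition In_ideal (K : fieldType) (n : nat) (p : {mpoly K[nvars n]}) : Prop :=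
  phi p = 0.

Definition act (R : comNzRingType) (n : nat) (s : {perm 'I_n}) (p : {mpoly R[nvars n]})
  : {mpoly R[nvars n]} :=
  comp_mpoly [tuple (let q := val (enum_val k) in yy R (s q.1) (s q.2)) | k < nvars n] p.

Definition pentad_sum (n : nat) : {mpoly int[nvars n]} :=
  \sum_(pi : {perm 'I_5})
     (-1) ^+ (odd_perm pi) *
     \prod_(k < 5) ynat int n (val (pi k)) (val (pi (ordS k))).

(* The pentad P = (1/10) * pentad_sum (exact division of integer coefficients),
   mapped into K via Z -> K. *)
Definition pentad (K : fieldType) (n : nat) : {mpoly K[nvars n]} :=
  \sum_(m <- msupp (pentad_sum n))
     ((((pentad_sum n)@_m) %/ 10)%Z)%:~R *: 'X_[m].

Definition offminor (K : fieldType) (n : nat) : {mpoly K[nvars n]} :=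
  \det (\matrix_(a < 3, b < 3) ynat K n (val a + 3) (val b)).

Definition gens (K : fieldType) (n : nat) (q : {mpoly K[nvars n]}) : Prop :=
  exists s : {perm 'I_n}, q = act s (pentad K n) \/ q = act s (offminor K n).

Definition in_ideal_gen (R : comNzRingType) (S : R -> Prop) (p : R) : Prop :=
  exists (m : nat) (c g : 'I_m -> R),
    (forall i, S (g i)) /\ p = \sum_(i < m) c i * g i.

(* Main.v *)
(** Call [J] the ideal generated by the orbits and give an edge [a < b] the
    interval [[a, b]] and the length [b - a].  A monomial without three pairwise
    disjoint intervals is pierced by two vertices [v < w]: each of its edges lies in
    the cell of [v] (the intervals containing [v]) or in the cell of [w].  For such a
    pair, a monomial is standard if, for a suitable strict order on the edges, it has
    no 2-chain of edges lying only in the cell of [v], no 2-chain of edges lying only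
    in the cell of [w], and no 3-chain whose middle edge lies in both cells.

    Spanning: modulo [J], every monomial is a combination of monomials that are longer,
    or of the same length and pierced by an earlier pair, or lighter for a weight
    attached to the pair.  Off-diagonal minors do this except for 3-chains with
    two edges sharing an end; there one uses elements [D * N' - D' * N] of [J],
    where [D], [D'] are 2-minors and [N], [N'] their images under the derivation
    [y_ab |-> y_xa y_xb] (the pentad is of this form).

    Independence: [phi] sends a monomial to the sum over all its 2-colourings of
    [s^(degrees of the first colour) t^(degrees of the second)].  A standard monomial
    has a colouring into two antichains, inside the cells of [v] and of [w].
    A monomial in the cell of [v] maximizes the length among those with the same
    degrees, and an antichain there is the unique one of least weight.  Hence in a combination of standard
    monomials the one that is shortest, then has the earliest pair, then is heaviest,
    contributes a term to the image under [phi] that nothing cancels. *)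
Require Import Defs.
From HB Require Import structures.
From mathcomp Require Import all_boot all_order all_algebra all_fingroup.
From mathcomp Require Import mpoly.
From mathcomp Require Import zify ring.
Set Implicit Arguments. Unset Strict Implicit. Unset Printing Implicit Defensive.
Import GRing.Theory.
Local Open Scope ring_scope.

(** * Edges and the ideal *)

Section Edges.
Variable n : nat.
Implicit Types (a b : 'I_n) (e f : 'I_(nvars n)).

Definition elo e : 'I_n := (val (enum_val e)).2.
Definition ehi e : 'I_n := (val (enum_val e)).1.

Lemma elo_lt e : (elo e < ehi e)%N.
Proof. exact: (valP (enum_val e)). Qed.

Lemma edge_inj e f : elo e = elo f -> ehi e = ehi f -> e = f.
Proof.
rewrite /elo /ehi => h1 h2; apply: enum_val_inj; apply: val_inj.
by case: (val (enum_val e)) (val (enum_val f)) h1 h2 => [x y] [z t] /= -> ->.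
Qed.

(** On the diagonal the exponent is [0], so ['X_[emon a a]] is 1 whereas [yy R a a] is 0; hence
    [a != b] in [yyE]. *)
Definition emon a b : 'X_{1..nvars n} :=
  if insub (a, b) is Some p then U_(enum_rank (p : pairs n))%MM
  else if insub (b, a) is Some p then U_(enum_rank (p : pairs n))%MM else 0%MM.

Lemma emonC a b : emon a b = emon b a.
Proof.
rewrite /emon; case: insubP => [p /= h e1|h]; case: insubP => [q /= h' e2|h'] //.
by move: h h' => /=; lia.
Qed.

Lemma emon_edge e : emon (ehi e) (elo e) = U_(e)%MM.
Proof.
rewrite /emon; case: insubP => [p _ hp|]; last by rewrite elo_lt.
suff -> : p = enum_val e by rewrite enum_valK.
by apply: val_inj; rewrite hp -surjective_pairing.
Qed.

Lemma yyE (R : nzRingType) a b : a != b -> yy R a b = 'X_[emon a b].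
Proof.
rewrite -val_eqE => ab; rewrite /yy /emon /yvar; case: insubP => [//|h1]; case: insubP => [//|h2].
by move: h1 h2 ab => /=; lia.
Qed.

Lemma yyC (R : nzRingType) a b : yy R a b = yy R b a.
Proof.
rewrite /yy; case: insubP => [p /= h e1|h]; case: insubP => [q /= h' e2|h'] //.
by move: h h' => /=; lia.
Qed.

Lemma yyaa (R : nzRingType) a : yy R a a = 0.
Proof. by rewrite /yy; case: insubP => [p|] //=; rewrite ltnn. Qed.

Lemma emon_ex a b : a != b -> exists2 e, emon a b = U_(e)%MM &
  (elo e = minn a b :> nat) /\ (ehi e = maxn a b :> nat).
Proof.
move=> ab; have [lt|ge] := ltnP a b.
  pose p : pairs n := Sub (b, a) lt; exists (enum_rank p).
    by rewrite emonC /emon; case: insubP => [q _ hq|]; rewrite ?lt //=; congr U_(enum_rank _)%MM; apply: val_inj.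
  by rewrite /elo /ehi enum_rankK /=; split; lia.
have {ge}lt : (b < a)%N by rewrite ltn_neqAle ge andbT eq_sym; apply: contra ab => /eqP/val_inj->.
pose p : pairs n := Sub (a, b) lt; exists (enum_rank p).
  by rewrite /emon; case: insubP => [q _ hq|]; rewrite ?lt //=; congr U_(enum_rank _)%MM; apply: val_inj.
by rewrite /elo /ehi enum_rankK /=; split; lia.
Qed.

End Edges.

(** * The ideal of the orbits; the action and [phi] as ring morphisms *)

Section Ideal.
Variables (K : fieldType) (n : nat).
Implicit Types (p q : {mpoly K[nvars n]}) (a b c d : 'I_n).
Notation J := (in_ideal_gen (@gens K n)).

Lemma idealD p q : J p -> J q -> J (p + q).
Proof.
case=> m1 [c1 [g1 [h1 ->]]] [m2 [c2 [g2 [h2 ->]]]].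
pose glue (T : Type) (u : 'I_m1 -> T) (v : 'I_m2 -> T) i :=
  match split i with inl j => u j | inr j => v j end.
exists (m1 + m2)%N, (glue _ c1 c2), (glue _ g1 g2); split.
  by move=> i; rewrite /glue; case: splitP.
rewrite big_split_ord /=; congr (_ + _); apply: eq_bigr => i _; rewrite /glue.
  by rewrite (unsplitK (inl _ i : 'I_m1 + 'I_m2)).
by rewrite (unsplitK (inr _ i : 'I_m1 + 'I_m2)).
Qed.

Lemma ideal0 : J 0.
Proof. by exists 0%N, (fun=> 0), (fun=> 0); split; [case | rewrite big_ord0]. Qed.

Lemma idealM p q : J q -> J (p * q).
Proof.
case=> m [c [g [h ->]]]; exists m, (fun i => p * c i), g; split=> //.
by rewrite mulr_sumr; apply: eq_bigr => i _; rewrite mulrA.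
Qed.

Lemma idealN p : J p -> J (- p).
Proof. by move=> /(idealM (-1)); rewrite mulN1r. Qed.

Lemma ideal_gen p : gens p -> J p.
Proof. by move=> h; exists 1%N, (fun=> 1), (fun=> p); split=> //; rewrite big_ord1 mul1r. Qed.

Lemma act_yy (R : comNzRingType) (s : {perm 'I_n}) a b : Defs.act s (yy R a b) = yy R (s a) (s b).
Proof.
have [->|ab] := eqVneq a b; first by rewrite !yyaa /Defs.act comp_mpoly0.
have [e he [h1 h2]] := emon_ex ab.
rewrite yyE // he /Defs.act comp_mpolyXU -tnth_nth tnth_mktuple -/(ehi e) -/(elo e).
have [lt|ge] := ltnP a b.
  have -> : ehi e = b by apply: val_inj => /=; lia.
  by have -> : elo e = a; [apply: val_inj => /=; lia | rewrite yyC].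
have -> : ehi e = a by apply: val_inj => /=; lia.
by have -> : elo e = b; first by apply: val_inj => /=; lia.
Qed.

Lemma phi_yy a b : a != b ->
  phi (yy K a b) = svar K a * svar K b + tvar K a * tvar K b.
Proof.
move=> ab; have [e he [h1 h2]] := emon_ex ab.
rewrite yyE // he /phi comp_mpolyXU -tnth_nth tnth_mktuple -/(ehi e) -/(elo e).
have [lt|ge] := ltnP a b.
  have -> : ehi e = b by apply: val_inj => /=; lia.
  have -> : elo e = a by apply: val_inj => /=; lia.
  by rewrite mulrC [X in _ + X]mulrC.
have -> : ehi e = a by apply: val_inj => /=; lia.
by have -> : elo e = b; first by apply: val_inj => /=; lia.
Qed.

HB.instance Definition _ (R : comNzRingType) (s : {perm 'I_n}) :=
  GRing.RMorphism.copy (@Defs.act R n s) (comp_mpoly _).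
HB.instance Definition _ :=
  GRing.RMorphism.copy (@phi K n) (comp_mpoly _).

End Ideal.

Lemma perm_map_seq (T : finType) (s t : seq T) :
  uniq s -> uniq t -> size s = size t -> exists p : {perm T}, map p s = t.
Proof.
elim: s t => [|x s IH] [|y t] //=; first by exists 1%g.
case/andP=> xs us /andP[yt ut] [/(IH _ us ut)[p hp]].
have pxt : p x \notin t by rewrite -hp mem_map //; apply: perm_inj.
exists (p * tperm (p x) y)%g; rewrite permM tpermL; congr (_ :: _).
rewrite -[RHS]hp; apply/eq_in_map => z zs; rewrite permM tpermD //.
  by apply: contraNneq xs => /perm_inj ->.
by apply: contraNneq yt => ->; rewrite -hp map_f.
Qed.

Lemma perm_of_uniq n k (s : seq 'I_n) (x0 : 'I_n) : (k <= n)%N -> uniq s -> size s = k ->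
  exists p : {perm 'I_n}, forall (i : 'I_n), (i < k)%N -> p i = nth x0 s i.
Proof.
move=> kn us sk; pose f (i : 'I_k) : 'I_n := widen_ord kn i.
have fi : injective f by move=> i j /(congr1 val) /= /val_inj.
have [p hp] := @perm_map_seq _ (map f (enum 'I_k)) s
  (etrans (map_inj_uniq fi _) (enum_uniq _)) us (etrans (etrans (size_map _ _) (size_enum_ord k)) (esym sk)).
exists p => i ik; rewrite -hp (nth_map x0) ?size_map ?size_enum_ord //.
rewrite (nth_map (Ordinal ik)) ?size_enum_ord //; congr (p _).
by apply: val_inj; rewrite /= nth_enum_ord.
by rewrite -enumT size_enum_ord.
Qed.

(** * Minors, the pentad and Koszul-type elements *)

(** A permutation amounts to the image [j] of 0 and a permutation of the rest. Iterating this turns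
    sums over ['S_3] and ['S_5] into explicit terms for [ring]. *)
Lemma big_lift_perm (R : nmodType) n (F : 'S_n.+1 -> R) :
  \sum_(s : 'S_n.+1) F s = \sum_(j < n.+1) \sum_(t : 'S_n) F (lift_perm ord0 j t).
Proof.
pose h (p : 'I_n.+1 * 'S_n) := lift_perm ord0 p.1 p.2.
have hi : injective h.
  move=> [j t] [j' t']; rewrite /h /= => /permP E.
  have ej : j = j' by have := E ord0; rewrite !lift_perm_id.
  rewrite -{}ej in E *; congr (_, _); apply/permP => k; apply: (@lift_inj _ j).
  by have := E (lift ord0 k); rewrite !lift_perm_lift.
have hb : bijective h.
  apply: inj_card_bij => //.
  by rewrite card_prod card_ord !card_Sn factS.
by rewrite (reindex h) ?pair_bigA //; apply: onW_bij.
Qed.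

Lemma big_perm0 (R : nmodType) (F : 'S_0 -> R) : \sum_(s : 'S_0) F s = F 1%g.
Proof. by rewrite (big_pred1 1%g) // => s; symmetry; apply/eqP/permP => -[]. Qed.

Definition det3 (R : nzRingType) (T : Type) (y : T -> T -> R) (a b c d e f : T) : R :=
  y a d * y b e * y c f + (- (y a d * y b f * y c e) + (- (y a e * y b d * y c f)
  + (y a e * y b f * y c d + (y a f * y b d * y c e - y a f * y b e * y c d)))).

Lemma det_mx3 (R : comNzRingType) (y : nat -> nat -> R) :
  \det (\matrix_(i < 3, j < 3) y i j) = det3 y 0%N 1%N 2%N 0%N 1%N 2%N.
Proof.
rewrite /determinant; under eq_bigr => s _ do rewrite !big_ord_recl big_ord0.
rewrite !big_lift_perm !big_ord_recl !big_ord0.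
rewrite !big_lift_perm !big_ord_recl !big_ord0.
rewrite !big_lift_perm !big_ord_recl !big_ord0 !big_perm0.
rewrite !odd_lift_perm odd_perm1 !lift_perm_lift !lift_perm_id !mxE /= /bump /= /det3.
by ring.
Qed.

(* The derivation [y p q |-> y x p * y x q] applied to [y a c * y b d - y a d * y b c]. *)
Definition der (R : nzRingType) (T : Type) (y : T -> T -> R) (x a b c d : T) : R :=
   y x a * y x c * y b d + y a c * (y x b * y x d)
 - (y x a * y x d * y b c + y a d * (y x b * y x c)).

(** Under [phi] the entries become inner products of the vectors [(s_i, t_i)], and [der] is the
    first-order change of a 2-minor when the form is perturbed by a rank one term given by [x]. If
    no diagonal entry occurs, this multiplies every 2-minor by [s_x^2 + t_x^2], so [phi] kills
    [kosz]. *)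
Definition kosz (R : nzRingType) (T : Type) (y : T -> T -> R) (x a b c d a' b' c' d' : T) : R :=
  (y a c * y b d - y a d * y b c) * der y x a' b' c' d'
  - (y a' c' * y b' d' - y a' d' * y b' c') * der y x a b c d.

(** The minors [12|34] and [13|24] share the term [y_14 y_23], so 4 of the 16 products cancel and
    one is left for each of the 12 pentagons. Each pentagon comes from 10 permutations of equal
    sign. *)
Lemma sum_perm5 (R : comNzRingType) (y : nat -> nat -> R) : (forall i j, y i j = y j i) ->
  \sum_(s : 'S_5) (-1) ^+ (odd_perm s) * \prod_(k < 5) y (val (s k)) (val (s (ordS k)))
  = kosz y 0%N 1%N 2%N 3%N 4%N 1%N 3%N 2%N 4%N *+ 10.
Proof.
move=> yC.
pose l0 n : 'I_n.+1 -> 'I_n.+2 := lift ord0.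
have o0 : ordS (ord0 : 'I_5) = l0 _ ord0 by apply: val_inj.
have o1 : ordS (l0 _ ord0 : 'I_5) = l0 _ (l0 _ ord0) by apply: val_inj.
have o2 : ordS (l0 _ (l0 _ ord0) : 'I_5) = l0 _ (l0 _ (l0 _ ord0)) by apply: val_inj.
have o3 : ordS (l0 _ (l0 _ (l0 _ ord0)) : 'I_5) = l0 _ (l0 _ (l0 _ (l0 _ ord0))) by apply: val_inj.
have o4 : ordS (l0 _ (l0 _ (l0 _ (l0 _ ord0))) : 'I_5) = ord0 by apply: val_inj.
pose f a b c d e := y a b * (y b c * (y c d * (y d e * y e a))).
pose B i j := bump i j.
transitivity (\sum_(0 <= a < 5) \sum_(0 <= b < 4) \sum_(0 <= c < 3) \sum_(0 <= d < 2)
  (-1) ^+ (odd a (+) (odd b (+) (odd c (+) odd d))) *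
  f a (B a b) (B a (B b c)) (B a (B b (B c d))) (B a (B b (B c (B d 0))))).
  under eq_bigr => s _ do rewrite !big_ord_recl big_ord0 -/(l0 _) o0 o1 o2 o3 o4 /l0.
  rewrite big_lift_perm big_mkord; apply: eq_bigr => a _.
  rewrite big_lift_perm big_mkord; apply: eq_bigr => b _.
  rewrite big_lift_perm big_mkord; apply: eq_bigr => c _.
  rewrite big_lift_perm big_mkord; apply: eq_bigr => d _.
  rewrite big_lift_perm big_ord_recl big_ord0 addr0 big_perm0.
  by rewrite !odd_lift_perm odd_perm1 !lift_perm_lift !lift_perm_id /= mulr1 !addbF !addbA.
rewrite unlock /= /B /bump /= /f /kosz /der.
rewrite !(yC 1%N 0%N) !(yC 2%N 0%N) !(yC 3%N 0%N) !(yC 4%N 0%N) !(yC 2%N 1%N) !(yC 3%N 1%N) !(yC 4%N 1%N) !(yC 3%N 2%N) !(yC 4%N 2%N) !(yC 4%N 3%N).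
by ring.
Qed.

Lemma ynatC (R : nzRingType) n i j : ynat R n i j = ynat R n j i.
Proof. by rewrite /ynat; case: insub => [a|]; case: insub => [b|] //; apply: yyC. Qed.

Lemma map_yy (n : nat) (K : fieldType) (a b : 'I_n) : map_mpoly (intr : int -> K) (yy int a b) = yy K a b.
Proof.
have [->|ab] := eqVneq a b; first by rewrite !yyaa raddf0.
by rewrite !yyE // map_mpolyX.
Qed.

Lemma map_ynat (n : nat) (K : fieldType) i j : map_mpoly (intr : int -> K) (ynat int n i j) = ynat K n i j.
Proof.
rewrite /ynat; case: insubP => [u _ _|_]; last by rewrite raddf0.
by case: insubP => [v _ _|_]; rewrite ?raddf0 ?map_yy.
Qed.

(** The division by 10 is exact over [int] and precedes the passage to [K], so the characteristic
    does not matter. *)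
Lemma pentadE (K : fieldType) n : pentad K n = kosz (ynat K n) 0%N 1%N 2%N 3%N 4%N 1%N 3%N 2%N 4%N.
Proof.
have sumE : pentad_sum n = kosz (ynat int n) 0%N 1%N 2%N 3%N 4%N 1%N 3%N 2%N 4%N *+ 10.
  rewrite -(sum_perm5 (@ynatC _ n)) /pentad_sum; exact: erefl.
transitivity (map_mpoly (intr : int -> K) (kosz (ynat int n) 0%N 1%N 2%N 3%N 4%N 1%N 3%N 2%N 4%N)); last first.
  by rewrite /kosz /der !(rmorphB, rmorphD, rmorphM) /= !map_ynat.
set P := kosz _ _ _ _ _ _ _ _ _ _ in sumE *.
apply/mpolyP => m; rewrite mcoeff_map_mpoly /= /pentad sumE raddf_sum /=.
have c10 k : ((P *+ 10)@_k %/ 10)%Z = P@_k.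
  rewrite mcoeffMn; have -> : P@_k *+ 10 = P@_k * 10%:Z :> int by rewrite -mulr_natr. exact: (@mulzK _ 10%:Z).
under eq_bigr => k _ do rewrite c10 mcoeffZ mcoeffX.
have [mP|mP] := boolP (m \in msupp (P *+ 10)).
  rewrite (bigD1_seq m) //= eqxx mulr1 big1 ?addr0 // => k /negPf ->; by rewrite mulr0.
rewrite big_seq big1 => [|k kP]; last by case: eqP => [e|]; rewrite ?mulr0 // -e kP in mP *.
by move: mP; rewrite -mcoeff_eq0 -c10 => /eqP ->; rewrite div0z mulr0z.
Qed.

Lemma offminorE (K : fieldType) n : offminor K n = det3 (ynat K n) 3%N 4%N 5%N 0%N 1%N 2%N.
Proof. by rewrite /offminor (@det_mx3 _ (fun i j => ynat K n (i + 3)%N j)). Qed.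

Ltac neq_labels :=
  repeat match goal with H : is_true (_ && _) |- _ => case/andP: H => ? ? end;
  rewrite /= ?andbT; repeat (apply/andP; split); by [| rewrite eq_sym].

(** * Minors and Koszul-type elements in the ideal *)

Section Membership.
Variables (K : fieldType) (n : nat).
Hypothesis hn : (6 <= n)%N.
Notation J := (in_ideal_gen (@gens K n)).
Notation y := (@yy K n).
Implicit Types (a b c d e f x : 'I_n).

Lemma act_ynat (s : {perm 'I_n}) x0 (t : seq 'I_n) k i j :
  (forall i : 'I_n, (i < k)%N -> s i = nth x0 t i) -> (k <= n)%N -> (i < k)%N -> (j < k)%N ->
  Defs.act s (ynat K n i j) = y (nth x0 t i) (nth x0 t j).
Proof.
move=> hs kn ik jk; have [iN jN] := (leq_trans ik kn, leq_trans jk kn).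
by rewrite /ynat !insubT act_yy !hs.
Qed.

(** A repeated row or column label makes the minor vanish; otherwise the six labels are distinct and
    a permutation carries [M] to the minor. *)
Lemma ideal_det3 a b c d e f :
  all (fun r => all (fun s => r != s) [:: d; e; f]) [:: a; b; c] -> J (det3 y a b c d e f).
Proof.
rewrite /= !andbT => /and3P[/and3P[ad ae af] /and3P[bd be bf] /and3P[cd ce cf]].
have [/and3P[ab ac bc]|dup] := boolP [&& a != b, a != c & b != c]; last first.
  suff -> : det3 y a b c d e f = 0 by apply: ideal0.
  by move: dup; rewrite !negb_and !negbK => /or3P[]/eqP->; rewrite /det3; ring.
have [/and3P[de df ef]|dup] := boolP [&& d != e, d != f & e != f]; last first.
  suff -> : det3 y a b c d e f = 0 by apply: ideal0.
  by move: dup; rewrite !negb_and !negbK => /or3P[]/eqP->; rewrite /det3; ring.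
pose t := [:: d; e; f; a; b; c].
have ut : uniq t.
  rewrite /= !inE !negb_or de df ef ab ac bc /= !(eq_sym d) !(eq_sym e) !(eq_sym f).
  by rewrite ad ae af bd be bf cd ce cf.
have [s hs] := perm_of_uniq a hn ut erefl.
apply: ideal_gen; exists s; right.
rewrite offminorE /det3 !(rmorphB, rmorphD, rmorphN, rmorphM) /=.
by rewrite !(act_ynat hs).
Qed.

Lemma ideal_kosz4 x a b c d : uniq [:: x; a; b; c; d] -> J (kosz y x a b c d a c b d).
Proof.
move=> ut; have [s hs] := perm_of_uniq a (ltnW hn) ut erefl.
apply: ideal_gen; exists s; left.
rewrite pentadE /kosz /der !(rmorphB, rmorphD, rmorphN, rmorphM) /=.
by rewrite !(act_ynat hs) // ltnW.
Qed.

Lemma phi_gens p : @gens K n p -> phi p = 0.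
Proof.
case=> s [] ->.
  rewrite pentadE.
  have lt5 i : (i < 5)%N -> (i < n)%N by move=> h; apply: leq_trans h (ltnW hn).
  (* The default vertex is arbitrary: only labels below 5 occur. *)
  pose v i := if insub i is Some j then s j else s (Ordinal (lt5 0%N isT)).
  have E i j : (i < 5)%N -> (j < 5)%N -> Defs.act s (ynat K n i j) = y (v i) (v j).
    by move=> hi hj; rewrite /ynat /v !insubT ?lt5 // => h1 h2; rewrite act_yy.
  have F i j : (i < 5)%N -> (j < 5)%N -> i != j -> phi (y (v i) (v j)) =
    svar K (v i) * svar K (v j) + tvar K (v i) * tvar K (v j).
    move=> hi hj ij; apply: phi_yy; rewrite /v !insubT ?lt5 // => h1 h2.
    by rewrite (inj_eq perm_inj) -val_eqE.
  rewrite /kosz /der !(rmorphB, rmorphD, rmorphN, rmorphM) /= !E // !F //.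
  by ring.
rewrite offminorE.
have lt6 i : (i < 6)%N -> (i < n)%N by move=> h; apply: leq_trans h hn.
pose v i := if insub i is Some j then s j else s (Ordinal (lt6 0%N isT)).
have E i j : (i < 6)%N -> (j < 6)%N -> Defs.act s (ynat K n i j) = y (v i) (v j).
  by move=> hi hj; rewrite /ynat /v !insubT ?lt6 // => h1 h2; rewrite act_yy.
have F i j : (i < 6)%N -> (j < 6)%N -> i != j -> phi (y (v i) (v j)) =
  svar K (v i) * svar K (v j) + tvar K (v i) * tvar K (v j).
  move=> hi hj ij; apply: phi_yy; rewrite /v !insubT ?lt6 // => h1 h2.
  by rewrite (inj_eq perm_inj) -val_eqE.
rewrite /det3 !(rmorphB, rmorphD, rmorphN, rmorphM) /= !E // !F //.
by ring.
Qed.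

Lemma phi_ideal p : J p -> phi p = 0.
Proof.
case=> m [c [g [h ->]]]; rewrite rmorph_sum /= big1 // => i _.
by rewrite rmorphM [X in _ * X](phi_gens (h i)) mulr0.
Qed.

(* Laplace expansion of [der] along the row of [x] turns [kosz] into a combination of 3-minors avoiding the diagonal. *)
Lemma ideal_kosz_sides x a b c d a' b' c' d' :
  all (fun r => all (fun s => r != s) [:: c; d; c'; d']) [:: a; b; a'; b'] ->
  x \notin [:: a; b; a'; b'; c; d; c'; d'] -> J (kosz y x a b c d a' b' c' d').
Proof.
move=> h; rewrite !inE !negb_or => hx.
have -> : kosz y x a b c d a' b' c' d' =
   (y a' x * y b' d' - y a' d' * y b' x) * det3 y x a b c' c d
 - (y a' x * y b' c' - y a' c' * y b' x) * det3 y x a b d' c d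
 + y x c * (y a d * det3 y b a' b' x c' d' - y b d * det3 y a a' b' x c' d')
 - y x d * (y a c * det3 y b a' b' x c' d' - y b c * det3 y a a' b' x c' d').
  rewrite /kosz /der /det3 !(yyC _ a x) !(yyC _ b x) !(yyC _ a' x) !(yyC _ b' x).
  by ring.
move: h; rewrite /= !andbT => h.
repeat first [apply: ideal_det3 | apply: idealD | apply: idealN | apply: idealM];
  neq_labels.
Qed.

(** A certificate for two minors sharing three labels: each [det3] on the right uses each of the six
    labels once. *)
Lemma kosz_shared x a b c d e : kosz y x a b c d a c b e =
   y x a * y b c * (det3 y x a d b c e - det3 y x a c b d e)
 + y x c * y a b * (det3 y x b d a c e - det3 y x b c a d e - det3 y x a e b c d)
 - y x b * y a c * det3 y x b e a c d.
Proof.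
rewrite /kosz /der /det3 !(yyC _ c a) !(yyC _ c b) !(yyC _ d a) !(yyC _ d b) !(yyC _ d c) !(yyC _ b a)
  !(yyC _ e a) !(yyC _ e b) !(yyC _ e c) !(yyC _ e d).
by ring.
Qed.

Lemma ideal_kosz_shared x a b c d e : uniq [:: x; a; b; c; d; e] -> J (kosz y x a b c d a c b e).
Proof.
rewrite /= !inE !negb_or => u; rewrite kosz_shared.
repeat first [apply: ideal_det3 | apply: idealD | apply: idealN | apply: idealM]; neq_labels.
Qed.

End Membership.

Ltac split_lia := rewrite /= ?inE ?negb_or; repeat (apply/andP; split); lia.

(** * Symmetries of [kosz], and the elements used for touching chains *)

Section Koszul.
Variables (K : fieldType) (n : nat).
Hypothesis hn : (6 <= n)%N.
Notation J := (in_ideal_gen (@gens K n)).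
Notation y := (@yy K n).
Implicit Types (a b c d x : 'I_n).

Lemma kosz_tr1 x a b c d (a' b' c' d' : 'I_n) :
  kosz y x a b c d a' b' c' d' = kosz y x c d a b a' b' c' d'.
Proof. by rewrite /kosz /der !(yyC _ c) !(yyC _ d a) !(yyC _ d b); ring. Qed.

Lemma kosz_anti x a b c d (a' b' c' d' : 'I_n) :
  kosz y x a b c d a' b' c' d' = - kosz y x a' b' c' d' a b c d.
Proof. by rewrite /kosz opprB. Qed.

Lemma kosz_row1 x a b c d (a' b' c' d' : 'I_n) :
  kosz y x a b c d a' b' c' d' = - kosz y x b a c d a' b' c' d'.
Proof. by rewrite /kosz /der; ring. Qed.

Lemma kosz_col1 x a b c d (a' b' c' d' : 'I_n) :
  kosz y x a b c d a' b' c' d' = - kosz y x a b d c a' b' c' d'.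
Proof. by rewrite kosz_tr1 kosz_row1 kosz_tr1. Qed.

Lemma kosz_row2 x a b c d (a' b' c' d' : 'I_n) :
  kosz y x a b c d a' b' c' d' = - kosz y x a b c d b' a' c' d'.
Proof. by rewrite kosz_anti kosz_row1 opprK -kosz_anti. Qed.

Lemma kosz_tr2 x a b c d (a' b' c' d' : 'I_n) :
  kosz y x a b c d a' b' c' d' = kosz y x a b c d c' d' a' b'.
Proof. by rewrite kosz_anti kosz_tr1 -kosz_anti. Qed.

(** [kosz] is additive in its second minor, and for symmetric [y] the three 2-minors on four labels
    satisfy a linear relation. *)
Lemma kosz_split x a b c d (a' b' c' d' : 'I_n) : kosz y x a b c d a' b' c' d' =
  kosz y x a b c d a' d' c' b' - kosz y x a b c d a' c' d' b'.
Proof. by rewrite /kosz /der !(yyC _ d') !(yyC _ c' b'); ring. Qed.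

(** Meant for a chain [(r1, x)], [(r2, c2)], [(x, c3)] and two further edges [(i, v)], [(w, j)]; the
    alternatives are the two ways to make these two edges a term of a 2-minor. If
    [{r1, r2} = {i, v}] or [{c3, c2} = {w, j}], rows and columns cannot be kept disjoint, and
    [kosz_split] or the pentad itself is used. *)
Lemma ideal_kosz_comp (x i v w j r1 r2 c2 c3 : 'I_n) :
  (i < v < x)%N -> (x < w < j)%N -> (r1 <= v)%N -> (r2 < v)%N -> (r1 == v :> nat) || (r1 < r2)%N ->
  (w < c2)%N -> (c3 == w :> nat) || (c2 < c3)%N ->
  J (kosz y x i w v j r1 r2 c3 c2) \/ J (kosz y x i j v w r1 r2 c3 c2).
Proof.
move=> h1 h2 h3 h4 h5 h6 h7.
have G a b c d (a' b' c' d' : 'I_n) :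
    all (fun r => all (fun s => r != s :> nat) [:: (c : nat); d : nat; c' : nat; d' : nat])
      [:: (a : nat); b : nat; a' : nat; b' : nat] ->
    (x : nat) \notin [:: (a : nat); b : nat; a' : nat; b' : nat; c : nat; d : nat; c' : nat; d' : nat] ->
    J (kosz y x a b c d a' b' c' d').
  by move=> s1 s2; apply: ideal_kosz_sides => //; move: s1 s2; rewrite /= !inE.
have T (a b c d e : 'I_n) : uniq [:: (x : nat); a : nat; b : nat; c : nat; d : nat; e : nat] -> J (kosz y x a b c d a c b e).
  move=> u; apply: ideal_kosz_shared => //; rewrite -(map_inj_uniq val_inj) //.
have idB p q : J p -> J q -> J (p - q) by move=> Jp Jq; apply: idealD => //; apply: idealN.
have [dl|ndl] := boolP ((r1 == v :> nat) && (i == r2 :> nat)); have [dr|ndr] := boolP ((c3 == w :> nat) && (j == c2 :> nat)).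
- case/andP: dl => /eqP/val_inj e1 /eqP/val_inj e2; case/andP: dr => /eqP/val_inj e3 /eqP/val_inj e4; subst; left.
  rewrite kosz_row2; apply: idealN; apply: ideal_kosz4 => //; rewrite -(map_inj_uniq val_inj); split_lia.
- case/andP: dl => /eqP/val_inj e1 /eqP/val_inj e2; subst r1 r2; left; rewrite kosz_split.
  have [/val_inj e|c3w] := eqVneq (c3 : nat) (w : nat).
    subst c3; apply: idB.
      by rewrite kosz_tr1; apply: G; split_lia.
    rewrite kosz_row1 kosz_row2 kosz_tr2 kosz_row2 kosz_tr2 !opprK.
    apply/idealN/T; split_lia.
  have [/val_inj e|jc2] := eqVneq (j : nat) (c2 : nat).
    subst c2; apply: idB; first by rewrite kosz_tr1; apply: G; split_lia.
    rewrite kosz_tr1 kosz_row1 kosz_tr2; apply/idealN/T; split_lia.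
  have [/val_inj e|jc3] := eqVneq (j : nat) (c3 : nat).
    subst c3; apply: idB; last by rewrite kosz_tr1; apply: G; split_lia.
    rewrite kosz_tr1 kosz_row1 kosz_tr2; apply/idealN/T; split_lia.
  by apply: idB; rewrite kosz_tr1; apply: G; split_lia.
- case/andP: dr => /eqP/val_inj e1 /eqP/val_inj e2; subst c3 c2; left; rewrite kosz_split.
  have [/val_inj e|r1v] := eqVneq (r1 : nat) (v : nat).
    subst r1; apply: idB; first by rewrite kosz_tr1; apply: G; split_lia.
    by rewrite kosz_tr1 kosz_col1; apply/idealN/T; split_lia.
  have [/val_inj e|ir1] := eqVneq (i : nat) (r1 : nat).
    subst r1; apply: idB; last by apply: G; split_lia.
    by rewrite kosz_col1; apply/idealN/T; split_lia.
  have [/val_inj e|ir2] := eqVneq (i : nat) (r2 : nat).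
    subst r2; apply: idB; first by rewrite kosz_tr1; apply: G; split_lia.
    rewrite kosz_col1 kosz_tr2 kosz_row2 kosz_tr2 kosz_row2 kosz_tr2 opprK.
    by apply/idealN/T; split_lia.
  apply: idB; last by apply: G; split_lia.
  by rewrite kosz_tr1; apply: G; split_lia.
(* [v] joins the rows exactly when [r1 = v], and [w] joins the columns exactly when [c3 = w]; this
   keeps rows and columns disjoint. *)
- have [r1v|r1v] := eqVneq (r1 : nat) v; have [c3w|c3w] := eqVneq (c3 : nat) w.
  + by left; rewrite kosz_tr1; apply: G; split_lia.
  + by right; rewrite kosz_tr1; apply: G; split_lia.
  + by right; apply: G; split_lia.
  + by left; apply: G; split_lia.
Qed.
End Koszul.

(** * Standard monomials span modulo the ideal *)

Section Weights.
Variable n : nat.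
Implicit Types (m : 'X_{1..nvars n}) (t : seq ('I_n * 'I_n)) (w : nat -> nat -> nat).

Definition wsum w m : nat := \sum_(e < nvars n) m e * w (elo e) (ehi e).

Lemma wsumD w m1 m2 : wsum w (m1 + m2)%MM = (wsum w m1 + wsum w m2)%N.
Proof. by rewrite /wsum -big_split /=; apply: eq_bigr => e _; rewrite mnmDE mulnDl. Qed.

Lemma wsum0 w : wsum w 0%MM = 0%N.
Proof. by rewrite /wsum big1 // => e _; rewrite mnm0E. Qed.

Lemma wsum1 w e : wsum w U_(e)%MM = w (elo e) (ehi e).
Proof.
rewrite /wsum (bigD1 e) //= big1 ?mnm1E ?eqxx ?mul1n ?addn0 // => i ie.
by rewrite mnm1E eq_sym (negPf ie).
Qed.

Definition loopless t := all (fun p => p.1 != p.2) t.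
Definition wseq w t := sumn [seq w (minn p.1 p.2) (maxn p.1 p.2) | p : 'I_n * 'I_n <- t].

Definition mseq t : 'X_{1..nvars n} := foldr (fun p m => (emon p.1 p.2 + m)%MM) 0%MM t.

Lemma wsum_emon w (a b : 'I_n) : a != b -> wsum w (emon a b) = w (minn a b) (maxn a b).
Proof. by case/emon_ex=> e -> [<- <-]; rewrite wsum1. Qed.

Lemma wsum_mseq w t : loopless t -> wsum w (mseq t) = wseq w t.
Proof.
elim: t => [|p t IH] /=; first by rewrite wsum0.
by case/andP=> hp /IH E; rewrite wsumD wsum_emon // E.
Qed.

Lemma mdeg_mseq t : loopless t -> mdeg (mseq t) = size t.
Proof.
elim: t => [|p t IH] /=; first by rewrite mdeg0.
case/andP=> hp /IH E; rewrite mdegD E; have [e -> _] := emon_ex hp.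
by rewrite mdeg1.
Qed.

Lemma mseq_gt0 t e : loopless t -> (0 < mseq t e)%N ->
  exists2 p, p \in t & (elo e = minn p.1 p.2 :> nat) /\ (ehi e = maxn p.1 p.2 :> nat).
Proof.
elim: t => [|p t IH] /=; first by rewrite mnm0E.
case/andP=> hp ht; rewrite mnmDE addn_gt0 => /orP[]; last first.
  by case/(IH ht)=> q qt hq; exists q; rewrite // inE qt orbT.
have [f -> hf] := emon_ex hp; rewrite mnm1E; case: eqP => // <- _.
by exists p; rewrite ?mem_head.
Qed.

Definition ends e : 'I_n * 'I_n := (elo e, ehi e).

Lemma loopless_ends s : loopless (map ends s).
Proof.
rewrite /loopless all_map; apply/allP => e _ /=.
by rewrite -val_eqE neq_ltn elo_lt.
Qed.

Lemma mseq_ends s : mseq (map ends s) = (\big[+%MM/0%MM]_(e <- s) U_(e))%MM.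
Proof.
elim: s => [|e s IH]; rewrite ?big_nil // big_cons /= IH.
by rewrite emonC emon_edge.
Qed.

Lemma mon_split m s : uniq s -> all (fun e => 0 < m e)%N s ->
  exists r, m = (mseq (map ends s) + r)%MM.
Proof.
move=> us ms; rewrite mseq_ends; exists (m - \big[+%MM/0%MM]_(e <- s) U_(e))%MM.
rewrite mpoly.addmC submK //; apply/mnm_lepP => e; rewrite mnm_sumE.
under eq_bigr => f _ do rewrite mnm1E.
have -> : (\sum_(f <- s) (f == e) = (e \in s))%N.
  rewrite -(count_uniq_mem _ us) -sum1_count [RHS]big_mkcond /=.
  by apply: eq_bigr => f _; case: (f == e).
by case: (boolP (e \in s)) => // /(allP ms).
Qed.

End Weights.
Arguments mseq {n}.
Arguments wseq {n}.
Arguments ends {n}.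

(** * Rewriting one term of a minor or of a Koszul-type element *)

Section Reduction.
Variables (K : fieldType) (n : nat).
Hypothesis hn : (6 <= n)%N.
Notation J := (in_ideal_gen (@gens K n)).
Notation y := (@yy K n).
Variable P : pred 'X_{1..nvars n}.
Implicit Types (p q : {mpoly K[nvars n]}) (a b c d e f x : 'I_n) (t : seq ('I_n * 'I_n)).

Definition reducible p := exists2 g, J g & forall m, m \in msupp (p - g) -> P m.

Lemma reducible_ideal p : J p -> reducible p.
Proof. by move=> Jp; exists p => // m; rewrite subrr msupp0. Qed.

Lemma reducible_std m : P m -> reducible 'X_[m].
Proof. by move=> Pm; exists 0; [apply: ideal0 | move=> m'; rewrite subr0 msuppX inE => /eqP->]. Qed.

Lemma reducibleD p q : reducible p -> reducible q -> reducible (p + q).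
Proof.
case=> g Jg hg [h Jh hh]; exists (g + h); first exact: idealD.
move=> m; rewrite opprD addrACA => /msuppD_le; rewrite mem_cat => /orP[/hg|/hh] //.
Qed.

Lemma reducibleZ (c : K) p : reducible p -> reducible (c *: p).
Proof.
case=> g Jg hg; exists (c *: g); first by rewrite -mul_mpolyC; apply: idealM.
by move=> m; rewrite -scalerBr => /msuppZ_le /hg.
Qed.

Lemma reducibleN p : reducible p -> reducible (- p).
Proof. by rewrite -scaleN1r; apply: reducibleZ. Qed.

Lemma reducible_sum (I : Type) (r : seq I) (F : I -> {mpoly K[nvars n]}) :
  (forall i, reducible (F i)) -> reducible (\sum_(i <- r) F i).
Proof.
move=> h; elim: r => [|i r IH]; first by rewrite big_nil; apply/reducible_ideal/ideal0.
by rewrite big_cons; apply: reducibleD.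
Qed.

Definition yprod t : {mpoly K[nvars n]} := foldr (fun ab p => y ab.1 ab.2 * p) 1 t.

Lemma yprodE t : loopless t -> yprod t = 'X_[mseq t].
Proof.
elim: t => [|p t IH] /=; first by rewrite mpolyX0.
by case/andP=> hp /IH ->; rewrite yyE // mpolyXD.
Qed.

(* All terms of the minor except the diagonal one. *)
Definition det3_tail a b c d e f : seq (seq ('I_n * 'I_n)) :=
  [:: [:: (a, d); (b, f); (c, e)]; [:: (a, e); (b, d); (c, f)]; [:: (a, e); (b, f); (c, d)];
      [:: (a, f); (b, d); (c, e)]; [:: (a, f); (b, e); (c, d)]].

Lemma reducible_det3 q a b c d e f :
  all (fun r => all (fun s => r != s) [:: d; e; f]) [:: a; b; c] ->
  (forall t, t \in det3_tail a b c d e f -> reducible (yprod t * q)) ->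
  reducible (yprod [:: (a, d); (b, e); (c, f)] * q).
Proof.
move=> h ht.
have -> : yprod [:: (a, d); (b, e); (c, f)] * q = q * det3 y a b c d e f +
   (yprod [:: (a, d); (b, f); (c, e)] * q + (yprod [:: (a, e); (b, d); (c, f)] * q +
    (- (yprod [:: (a, e); (b, f); (c, d)] * q) + (- (yprod [:: (a, f); (b, d); (c, e)] * q) +
    yprod [:: (a, f); (b, e); (c, d)] * q)))) by rewrite /yprod /det3 /=; ring.
repeat apply: reducibleD; try apply: reducibleN; try by apply: ht; rewrite !inE eqxx ?orbT.
by apply/reducible_ideal/idealM/ideal_det3.
Qed.

(* All terms of [kosz] except [y a' c' * y b' d' * (y a x * y x c * y b d)]. *)
Definition kosz_tail x a' b' c' d' a b c d : seq (seq ('I_n * 'I_n)) :=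
  [seq (a', c') :: (b', d') :: t | t <-
     [:: [:: (a, c); (b, x); (x, d)]; [:: (a, x); (x, d); (b, c)]; [:: (a, d); (b, x); (x, c)]]]
  ++ [seq (a', d') :: (b', c') :: t | t <- [:: [:: (a, x); (x, c); (b, d)];
        [:: (a, c); (b, x); (x, d)]; [:: (a, x); (x, d); (b, c)]; [:: (a, d); (b, x); (x, c)]]]
  ++ [seq s ++ t | s <- [:: [:: (a, c); (b, d)]; [:: (a, d); (b, c)]],
       t <- [:: [:: (x, a'); (x, c'); (b', d')]; [:: (a', c'); (x, b'); (x, d')];
                [:: (x, a'); (x, d'); (b', c')]; [:: (a', d'); (x, b'); (x, c')]]].

Lemma reducible_kosz q x a' b' c' d' a b c d :
  J (kosz y x a' b' c' d' a b c d) ->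
  (forall t, t \in kosz_tail x a' b' c' d' a b c d -> reducible (yprod t * q)) ->
  reducible (yprod [:: (a', c'); (b', d'); (a, x); (x, c); (b, d)] * q).
Proof.
move=> JK ht; pose T s := yprod s * q.
have -> : yprod [:: (a', c'); (b', d'); (a, x); (x, c); (b, d)] * q =
  q * kosz y x a' b' c' d' a b c d
  - T [:: (a', c'); (b', d'); (a, c); (b, x); (x, d)]
  + T [:: (a', c'); (b', d'); (a, x); (x, d); (b, c)]
  + T [:: (a', c'); (b', d'); (a, d); (b, x); (x, c)]
  + T [:: (a', d'); (b', c'); (a, x); (x, c); (b, d)]
  + T [:: (a', d'); (b', c'); (a, c); (b, x); (x, d)]
  - T [:: (a', d'); (b', c'); (a, x); (x, d); (b, c)]
  - T [:: (a', d'); (b', c'); (a, d); (b, x); (x, c)]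
  + T [:: (a, c); (b, d); (x, a'); (x, c'); (b', d')]
  + T [:: (a, c); (b, d); (a', c'); (x, b'); (x, d')]
  - T [:: (a, c); (b, d); (x, a'); (x, d'); (b', c')]
  - T [:: (a, c); (b, d); (a', d'); (x, b'); (x, c')]
  - T [:: (a, d); (b, c); (x, a'); (x, c'); (b', d')]
  - T [:: (a, d); (b, c); (a', c'); (x, b'); (x, d')]
  + T [:: (a, d); (b, c); (x, a'); (x, d'); (b', c')]
  + T [:: (a, d); (b, c); (a', d'); (x, b'); (x, c')].
  by rewrite /T /yprod /kosz /der /= (yyC _ x a) (yyC _ x b); ring.
repeat apply: reducibleD; try apply: reducibleN; try by apply: ht; rewrite !inE eqxx ?orbT.
by apply/reducible_ideal/idealM.
Qed.

End Reduction.

(** * Piercing pairs and standard monomials *)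

Section Standard.
Variable n : nat.
Hypothesis n0 : (0 < n)%N.
Implicit Types (m : 'X_{1..nvars n}) (k : nat) (e f g : 'I_(nvars n)).

Definition elen (a b : nat) := (b - a)%N.
Definition cell (v a b : nat) := (a <= v <= b)%N.
(* The index [k = q * n + v] encodes the pair of piercing vertices [v] and
   [w = v + q + 1]; [w] may exceed [n - 1], and then its cell is empty. *)
Definition cv k := (k %% n)%N.
Definition cw k := (cv k + (k %/ n).+1)%N.
Definition inC k (a b : nat) := cell (cv k) a b || cell (cw k) a b.
Definition suppC k m := [forall e, (0 < m e)%N ==> inC k (elo e) (ehi e)].
(* Equal to [n * n] when no pair pierces [m]. *)
Definition cidx m := find (suppC^~ m) (iota 0 (n * n)).

(* Position of a lower (resp. upper) end in the usual order of the vertices with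
   [v] moved to the front (resp. [w] moved to the back). *)
Definition rho k (i : nat) := if i == cv k then 1%N else i.+2.
Definition kap k (j : nat) := if j == cw k then n.+1 else j.+1.
(** By the rearrangement inequality, permuting the upper ends along a chain for [ltC] lowers this
    weight. *)
Definition cwt k (a b : nat) := (rho k a * kap k b)%N.
Definition ltC k e f := (rho k (elo e) < rho k (elo f))%N && (kap k (ehi e) < kap k (ehi f))%N.

(** Used for edges satisfying [inC]: missing the cell of [w] then means lying in the cell of [v]
    alone. Likewise for [onlyw]. *)
Definition onlyv k e := ~~ cell (cw k) (elo e) (ehi e).
Definition onlyw k e := ~~ cell (cv k) (elo e) (ehi e).
Definition both k e := cell (cv k) (elo e) (ehi e) && cell (cw k) (elo e) (ehi e).

Definition badpair k m e f := [&& (0 < m e)%N, (0 < m f)%N, ltC k e f &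
  (onlyv k e && onlyv k f) || (onlyw k e && onlyw k f)].
Definition badtriple k m e f g := [&& (0 < m e)%N, (0 < m f)%N, (0 < m g)%N,
  ltC k e f, ltC k f g & both k f].
Definition stdC k m := ~~ [exists e, exists f, badpair k m e f] &&
  ~~ [exists e, exists f, exists g, badtriple k m e f g].
Definition std m := (cidx m < n * n)%N && stdC (cidx m) m.

Lemma cvE q v : (v < n)%N -> cv (q * n + v) = v.
Proof. by move=> vn; rewrite /cv modnMDl modn_small. Qed.

Lemma cwE q v : (v < n)%N -> cw (q * n + v) = (v + q.+1)%N.
Proof. by move=> vn; rewrite /cw cvE // divnMDl // divn_small // addn0. Qed.

Lemma cv_lt k : (cv k < n)%N.
Proof. by rewrite /cv ltn_mod. Qed.

Lemma cvw k : (cv k < cw k)%N.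
Proof. by rewrite /cw addnS ltnS leq_addr. Qed.

Lemma suppCP k m e : suppC k m -> (0 < m e)%N -> inC k (elo e) (ehi e).
Proof. by move/forallP/(_ e)/implyP. Qed.

Lemma suppC_cidx m : (cidx m < n * n)%N -> suppC (cidx m) m.
Proof.
move=> h; have := @nth_find _ 0%N (suppC^~ m) (iota 0 (n * n)).
by rewrite has_find size_iota => /(_ h); rewrite nth_iota.
Qed.

Lemma cidx_min m k : (k < cidx m)%N -> ~~ suppC k m.
Proof.
move=> h; have h2 : (k < n * n)%N.
  by apply: leq_trans h _; rewrite -[X in (_ <= X)%N](size_iota 0) find_size.
by have := before_find 0%N h; rewrite nth_iota // add0n => ->.
Qed.

Lemma cidx_le m k : (k < n * n)%N -> suppC k m -> (cidx m <= k)%N.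
Proof. by move=> kn; rewrite leqNgt; apply: contraL; apply: cidx_min. Qed.

Definition disjoint3 m := [exists e, exists f, exists g,
  [&& (0 < m e)%N, (0 < m f)%N, (0 < m g)%N, (ehi e < elo f)%N & (ehi f < elo g)%N]].

(** Greedy piercing: [v] is the least upper end, and [w] the least upper end among the edges that
    begin after [v]. An edge missed by both would begin after [w] and give three disjoint
    intervals. *)
Lemma comp_exists m : ~~ disjoint3 m -> (cidx m < n * n)%N.
Proof.
move=> nd; suff [q [v [vn qn h]]] : exists q v, [/\ (v < n)%N, (q < n)%N & suppC (q * n + v) m].
  have qv : (q * n + v < n * n)%N.
    by apply: (@leq_trans (q.+1 * n)); [rewrite mulSn; lia | rewrite leq_mul2r qn orbT].
  exact: leq_ltn_trans (cidx_le qv h) qv.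
have [/existsP[e0 me0]|/existsPn m0] := boolP [exists e, (0 < m e)%N]; last first.
  exists 0%N, 0%N; split=> //; apply/forallP => e; apply/implyP => me.
  by have := m0 e; rewrite me.
case: (@arg_minnP _ e0 (fun e => 0 < m e)%N (fun e => val (ehi e)) me0) => e1 me1 min1.
pose v := val (ehi e1); have vn : (v < n)%N by apply: ltn_ord.
have [/existsP[f0 /andP[mf0 lf0]]|/existsPn m0] := boolP [exists e, (0 < m e)%N && (v < elo e)%N];
  last first.
  exists 0%N, v; split=> //; apply/forallP => e; apply/implyP => me.
  have := m0 e; rewrite me -leqNgt /= => lv.
  by rewrite /inC cvE // /cell lv min1.
case: (@arg_minnP _ f0 (fun e => (0 < m e) && (v < elo e))%N (fun e => val (ehi e)))
  => [|f1 /andP[mf1 lf1] min2]; first by rewrite mf0.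
have fn := ltn_ord (ehi f1); have l1 := elo_lt f1.
exists (ehi f1 - v.+1)%N, v; split=> //; first by lia.
apply/forallP => e; apply/implyP => me.
have W : cw ((ehi f1 - v.+1) * n + v) = ehi f1 by rewrite cwE //; lia.
rewrite /inC cvE // W /cell min1 // andbT.
have [//|lv] := leqP (elo e) v; rewrite min2 ?me // andbT /=.
rewrite leqNgt; apply: contra nd => lw; apply/existsP; exists e1; apply/existsP; exists f1.
by apply/existsP; exists e; rewrite me1 mf1 me lf1 lw.
Qed.

(* By minimality of [k], the pair cannot be replaced by [(v, w - 1)] or [(v + 1, w)]. *)
Lemma gap_edges m k : k = cidx m -> (k < n * n)%N -> ((cv k).+1 < cw k)%N ->
  exists e f, [/\ (0 < m e)%N, (0 < m f)%N, ehi e = cv k :> nat & elo f = cw k :> nat].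
Proof.
move=> km kn gap; have sk : suppC k m by rewrite km suppC_cidx -?km.
have vn := cv_lt k.
have [q [kE wE]] : exists q, k = (q * n + cv k)%N /\ cw k = (cv k + q.+1)%N.
  by exists (k %/ n)%N; split=> //; apply: divn_eq.
have q0 : (0 < q)%N by lia.
have [f [mf lf]] : exists f, (0 < m f)%N /\ elo f = cw k :> nat.
  have : ~~ suppC (q.-1 * n + cv k) m.
    by apply: cidx_min; rewrite -km [X in (_ < X)%N]kE ltn_add2r ltn_mul2r n0 /=; lia.
  rewrite negb_forall => /existsP[f]; rewrite negb_imply => /andP[mf nf]; exists f; split=> //.
  move: nf (suppCP sk mf) (elo_lt f); rewrite /inC cvE // cwE // /cell; lia.
(* As an end of an edge [w] is below [n], hence so is [v + 1], and the index [q.-1 * n + (v + 1)]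
   really encodes [(v + 1, w)]. *)
have wn : (cw k < n)%N by rewrite -lf.
have [e [me le]] : exists e, (0 < m e)%N /\ ehi e = cv k :> nat.
  have v1 : ((cv k).+1 < n)%N by lia.
  have : ~~ suppC (q.-1 * n + (cv k).+1) m.
    apply: cidx_min; rewrite -km [X in (_ < X)%N]kE; case: (q) q0 => // q' _; rewrite mulSn /=; lia.
  rewrite negb_forall => /existsP[e]; rewrite negb_imply => /andP[me ne]; exists e; split=> //.
  move: ne (suppCP sk me) (elo_lt e); rewrite /inC cvE // cwE // /cell; lia.
by exists e, f.
Qed.

End Standard.

Ltac elen_lia :=
  rewrite /wseq /= /elen;
  repeat match goal with |- context [(maxn ?a ?b - minn ?a ?b)%N] =>
    let D := fresh "D" in
    set D := (maxn a b - minn a b)%N;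
    first [have: (D + a = b)%N by rewrite /D; lia | have: (D + b = a)%N by rewrite /D; lia];
    clearbody D; move=> ?
  end; lia.

Ltac minmax :=
  repeat match goal with
  | |- context [minn ?a ?b] =>
      first [have -> : minn a b = a by lia | have -> : minn a b = b by lia]
  | |- context [maxn ?a ?b] =>
      first [have -> : maxn a b = a by lia | have -> : maxn a b = b by lia]
  end.

Ltac cases_or := first [case/orP; [move/eqP-> | cases_or] | move/eqP->].

Ltac ord_neq := rewrite /= -?val_eqE /=; repeat (apply/andP; split); lia.

Lemma rho_lt n k a b : (rho n k a < rho n k b)%N -> b <> cv n k /\ (a = cv n k \/ (a < b)%N).
Proof. by rewrite /rho; case: eqP; case: eqP; lia. Qed.

Lemma kap_lt n k a b : (b < n)%N -> (kap n k a < kap n k b)%N ->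
  a <> cw n k /\ (b = cw n k \/ (a < b)%N).
Proof. by rewrite /kap; case: eqP; case: eqP; lia. Qed.

Lemma rearrange2 a b c d : (a < b)%N -> (c < d)%N -> (a * d + b * c < a * c + b * d)%N.
Proof. nia. Qed.

(** The bounds come in the order of the terms of [det3_tail]. *)
Lemma rearrange3 a b c d e f : (a < b)%N -> (b < c)%N -> (d < e)%N -> (e < f)%N ->
  [&& a * d + b * f + c * e < a * d + b * e + c * f,
      a * e + b * d + c * f < a * d + b * e + c * f,
      a * e + b * f + c * d < a * d + b * e + c * f,
      a * f + b * d + c * e < a * d + b * e + c * f &
      a * f + b * e + c * d < a * d + b * e + c * f]%N.
Proof.
move=> /subnK <- /subnK <- /subnK <- /subnK <-.
by repeat (apply/andP; split); nia.
Qed.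

(** * The reduction steps and the induction *)

Section Spanning.
Variables (K : fieldType) (n : nat).
Hypothesis hn : (6 <= n)%N.
Implicit Types (m r : 'X_{1..nvars n}) (k : nat) (e f g : 'I_(nvars n)) (t s : seq ('I_n * 'I_n)).
Notation red := (@reducible K n (@std n)).

Let n0 : (0 < n)%N. Proof. exact: leq_trans hn. Qed.

Section LongerReducible.
Variable m : 'X_{1..nvars n}.
Hypothesis longer : forall m', mdeg m' = mdeg m -> (wsum elen m < wsum elen m')%N -> red 'X_[m'].

Lemma red_longer m1 s r t : mdeg m1 = mdeg m -> (wsum elen m <= wsum elen m1)%N ->
  m1 = (mseq s + r)%MM -> loopless s -> loopless t -> size t = size s ->
  (wseq elen s < wseq elen t)%N -> red (yprod K t * 'X_[r]).
Proof.
move=> dm lm m1E ls lt st lst; rewrite yprodE // -mpolyXD; apply: longer.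
  by rewrite -dm m1E !mdegD !mdeg_mseq // st.
apply: leq_ltn_trans lm _; rewrite m1E !wsumD !wsum_mseq //; lia.
Qed.

(** In every other term of the minor some lower end is matched with an upper end to its left, so the
    total length grows. *)
Lemma red_disjoint3 m1 : mdeg m1 = mdeg m -> (wsum elen m <= wsum elen m1)%N ->
  disjoint3 m1 -> red 'X_[m1].
Proof.
move=> dm lm /existsP[e /existsP[f /existsP[g /and5P[me mf mg ef fg]]]].
have le := elo_lt e; have lf := elo_lt f; have lg := elo_lt g.
have us : uniq [:: e; f; g].
  rewrite /= !inE !negb_or andbT; apply/andP; split; [apply/andP; split|]; apply/eqP => E;
  move: ef fg; rewrite ?E; lia.
have [|r m1E] := @mon_split _ m1 _ us; first by rewrite /= me mf mg.
have ls := loopless_ends [:: e; f; g].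
rewrite m1E mpolyXD -yprodE //; apply: reducible_det3 => //; first by ord_neq.
move=> t; rewrite !inE => /or4P[|||/orP[]] /eqP->;
  (apply: (red_longer dm lm m1E ls) => //; [by ord_neq | by elen_lia]).
Qed.

Section SameLength.
Variable k : nat.
Hypothesis suppm : suppC k m.
Hypothesis lighter : forall m', mdeg m' = mdeg m -> wsum elen m' = wsum elen m -> suppC k m' ->
  (wsum (cwt n k) m' < wsum (cwt n k) m)%N -> red 'X_[m'].

Lemma red_lighter s r t :
  m = (mseq s + r)%MM -> loopless s -> loopless t -> size t = size s ->
  wseq elen s = wseq elen t -> all (fun p : 'I_n * 'I_n => inC n k (minn p.1 p.2) (maxn p.1 p.2)) t ->
  (wseq (cwt n k) t < wseq (cwt n k) s)%N -> red (yprod K t * 'X_[r]).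
Proof.
move=> mE ls lt st lst tC wt; rewrite yprodE // -mpolyXD; apply: lighter.
- by rewrite mE !mdegD !mdeg_mseq // st.
- by rewrite mE !wsumD !wsum_mseq // lst.
- apply/forallP => e; apply/implyP; rewrite mnmDE addn_gt0 => /orP[].
    by case/(mseq_gt0 lt) => p pt [-> ->]; apply: (allP tC).
  by move=> re; apply: suppCP suppm _; rewrite mE mnmDE addn_gt0 re orbT.
- by rewrite mE !wsumD !wsum_mseq // ltn_add2r.
Qed.


Hypothesis kE : k = cidx m.
Hypothesis kn : (k < n * n)%N.

(** A gap edge on the far side ([h] beginning at [w], or [g] ending at [v]) is disjoint from [e] and
    [f]. In the minor of the three edges, exchanging the ends of [e] and [f] keeps the length and
    lowers the weight; every other term is longer. *)
Lemma red_badpair e f : badpair k m e f -> red 'X_[m].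
Proof.
case/and4P=> me mf ef0; have /andP[/rho_lt[fv ef] /(kap_lt (ltn_ord _))[ew efc]] := ef0 => ovw.
have le := elo_lt e; have lf := elo_lt f.
have [Ce Cf] := (suppCP suppm me, suppCP suppm mf); have vw := cvw n k.
(* Two distinct upper ends lie in [[v, w)], or two distinct lower ends in [(v, w]]. *)
have gap : ((cv n k).+1 < cw n k)%N.
  by move: ovw Ce Cf; rewrite /onlyv /onlyw /inC /cell; lia.
have [g [h [mg mh gE hE]]] := gap_edges n0 kE kn gap.
have lg := elo_lt g; have lh := elo_lt h.
have [rfe kfe] : (rho n k (elo e) < rho n k (elo f))%N /\ (kap n k (ehi e) < kap n k (ehi f))%N.
  by case/andP: ef0.
have [V|W] : [&& (elo e <= cv n k)%N, (elo f < cv n k)%N, (cv n k <= ehi e)%N,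
     (ehi e < ehi f)%N & (ehi f < cw n k)%N] \/
   [&& (cv n k < elo e)%N, (elo e < elo f)%N, (elo f <= cw n k)%N, (cw n k < ehi e)%N
     & (cw n k <= ehi f)%N].
- by move: ovw Ce Cf; rewrite /onlyv /onlyw /inC /cell; lia.
all: clear Ce Cf ovw ef0 ef efc fv ew.
- have us : uniq [:: e; f; h].
    by rewrite /= !inE !negb_or andbT; repeat (apply/andP; split); apply/eqP => E;
       move: rfe V hE lh; rewrite ?E; lia.
  have [|r mE] := @mon_split _ m _ us; first by rewrite /= me mf mh.
  have ls := loopless_ends [:: e; f; h].
  rewrite mE mpolyXD -yprodE //; apply: reducible_det3 => //; first by ord_neq.
  move=> t; rewrite !inE => /or4P[|||/orP[]] /eqP->;
    try by apply: (red_longer erefl (leqnn _) mE ls) => //; [ord_neq | elen_lia].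
  apply: (red_lighter mE ls) => //; [by ord_neq|by elen_lia| |].
    by rewrite /= /inC /cell; lia.
  rewrite /wseq /=; minmax; rewrite /cwt.
  by have := rearrange2 rfe kfe; lia.
- have us : uniq [:: g; e; f].
    by rewrite /= !inE !negb_or andbT; repeat (apply/andP; split); apply/eqP => E;
       move: rfe W gE lg; rewrite ?E; lia.
  have [|r mE] := @mon_split _ m _ us; first by rewrite /= me mf mg.
  have ls := loopless_ends [:: g; e; f].
  rewrite mE mpolyXD -yprodE //; apply: reducible_det3 => //; first by ord_neq.
  move=> t; rewrite !inE => /or4P[|||/orP[]] /eqP->;
    try by apply: (red_longer erefl (leqnn _) mE ls) => //; [ord_neq | elen_lia].
  apply: (red_lighter mE ls) => //; [by ord_neq|by elen_lia| |].
    by rewrite /= /inC /cell; lia.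
  rewrite /wseq /=; minmax; rewrite /cwt.
  by have := rearrange2 rfe kfe; lia.
Qed.

(** If [elo g = ehi e] the minor would have a diagonal entry, and [kosz] replaces it. Otherwise the
    terms not pairing [elo g] with [ehi e] are lighter. The other two are longer if [ehi e < elo g].
    If [elo g < ehi e], they are lighter when the new edge contains [v] or [w]; when it does not, it
    lies strictly between and forms three disjoint intervals with the gap edges. *)
Lemma red_badtriple e f g : badtriple k m e f g -> red 'X_[m].
Proof.
case/and5P=> me mf mg ef0 /andP[fg0 bf].
have [/andP[rfe kfe] /andP[rfg kfg]] := (ef0, fg0).
have le := elo_lt e; have lf := elo_lt f; have lg := elo_lt g; have vw := cvw n k.
have [A1 [A2 A3]] : [&& (elo e <= cv n k)%N, (elo f < cv n k)%N, (cv n k <= ehi e)%N,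
    (ehi e < ehi f)%N, (cw n k < ehi f)%N, (cw n k <= ehi g)%N, (elo f < elo g)%N &
    (elo g <= cw n k)%N] /\
  ((ehi e != cw n k :> nat) && (elo g != cv n k :> nat) /\
  ((elo e == cv n k :> nat) || (elo e < elo f)%N) && ((ehi g == cw n k :> nat) || (ehi f < ehi g)%N)).
  move: (suppCP suppm me) (suppCP suppm mg) bf.
  move: (rho_lt rfe) (rho_lt rfg) (kap_lt (ltn_ord _) kfe) (kap_lt (ltn_ord _) kfg).
  by rewrite /inC /both /cell; lia.
have us : uniq [:: e; f; g].
  rewrite /= !inE !negb_or andbT; repeat (apply/andP; split); apply/eqP => E;
  by move: rfe rfg; rewrite ?E; lia.
have [|r mE] := @mon_split _ m _ us; first by rewrite /= me mf mg.
have ls := loopless_ends [:: e; f; g].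
have [touch|ntouch] := eqVneq (elo g : nat) (ehi e : nat).
  (* The edges [e'], [f'] of [gap_edges] complete the chain to a term of [kosz]. *)
  clear us r mE ls.
  have bE : elo g = ehi e by apply: val_inj.
  have gap : ((cv n k).+1 < cw n k)%N by clear A3; lia.
  have [e' [f' [me' mf' eE fE]]] := gap_edges n0 kE kn gap.
  have le' := elo_lt e'; have lf' := elo_lt f'.
  have us : uniq [:: e'; f'; e; g; f].
    rewrite /= !inE !negb_or andbT; repeat (apply/andP; split); apply/eqP => E;
    by clear A3; move: A1 A2 eE fE le' lf' touch; rewrite ?E; lia.
  have [|r mE] := @mon_split _ m _ us; first by rewrite /= me mf mg me' mf'.
  have ls := loopless_ends [:: e'; f'; e; g; f].
  have sE : map ends [:: e'; f'; e; g; f] = [:: (elo e', ehi e'); (elo f', ehi f'); (elo e, ehi e);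
      (ehi e, ehi g); (elo f, ehi f)] by rewrite /= /ends bE.
  rewrite {}sE in mE ls; rewrite bE in rfg A1 A2 A3; clear us touch.
  have rr := rearrange3 rfe rfg kfe kfg.
  have B1 : (elo e' < ehi e' < ehi e)%N by clear rr rfe rfg kfe kfg A3; lia.
  have B2 : (ehi e < elo f' < ehi f')%N by clear rr rfe rfg kfe kfg A3; lia.
  have JJ : in_ideal_gen (@gens K n) (kosz (@yy K n) (ehi e) (elo e') (elo f') (ehi e') (ehi f')
        (elo e) (elo f) (ehi g) (ehi f)) \/
     in_ideal_gen (@gens K n) (kosz (@yy K n) (ehi e) (elo e') (ehi f') (ehi e') (elo f')
        (elo e) (elo f) (ehi g) (ehi f)).
    apply: ideal_kosz_comp => //; rewrite ?eE ?fE; clear rr rfe rfg kfe kfg; lia.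
  clear A2 A3 me mf mg me' mf' bf ef0 fg0 rfe rfg kfe kfg bE gap.
  case: JJ => JJ.
  { rewrite mE mpolyXD -yprodE //; apply: (reducible_kosz JJ) => t.
    rewrite /kosz_tail /= !inE; cases_or.
    (* These three terms keep [e'] and [f'] and permute the chain; each of the others breaks up a
       gap edge and is longer. *)
    1-3: apply: (red_lighter mE ls) => //; [by clear rr; ord_neq | by clear rr; elen_lia
      | by clear rr; rewrite /= /inC /cell; lia
      | by move: rr => + ; rewrite /wseq /=; minmax => rr; rewrite /cwt; clear -rr; lia].
    all: by clear rr; apply: (red_longer erefl (leqnn _) mE ls) => //; [ord_neq | elen_lia]. }
  (* In this alternative [f'] is the entry with row [ehi f'] and column [elo f']. *)
  { have -> : m = (mseq [:: (elo e', ehi e'); (ehi f', elo f'); (elo e, ehi e);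
      (ehi e, ehi g); (elo f, ehi f)] + r)%MM by rewrite mE /= (emonC (elo f')).
  rewrite mpolyXD -yprodE; last by clear rr; ord_neq.
  apply: (reducible_kosz JJ) => t.
  rewrite /kosz_tail /= !inE; cases_or.
  1-3: apply: (red_lighter mE ls) => //; [by clear rr; ord_neq | by clear rr; elen_lia
      | by clear rr; rewrite /= /inC /cell; lia
      | by move: rr => + ; rewrite /wseq /=; minmax => rr; rewrite /cwt; clear -rr; lia].
  all: by clear rr; apply: (red_longer erefl (leqnn _) mE ls) => //; [ord_neq | elen_lia]. }
clear A2 A3 ef0 fg0 bf.
rewrite mE mpolyXD -yprodE //; apply: reducible_det3 => //.
  by clear -A1 le lf lg vw ntouch; ord_neq.
have L1 : red (yprod K [:: (elo e, ehi e); (elo f, ehi g); (elo g, ehi f)] * 'X_[r]).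
  apply: (red_lighter mE ls) => //; [ord_neq|elen_lia|rewrite /= /inC /cell; lia|].
  by rewrite /wseq /=; minmax; rewrite /cwt; have rr := rearrange3 rfe rfg kfe kfg; clear -rr; lia.
have L2 : red (yprod K [:: (elo e, ehi f); (elo f, ehi e); (elo g, ehi g)] * 'X_[r]).
  apply: (red_lighter mE ls) => //; [ord_neq|elen_lia|rewrite /= /inC /cell; lia|].
  by rewrite /wseq /=; minmax; rewrite /cwt; have rr := rearrange3 rfe rfg kfe kfg; clear -rr; lia.
have L4 : red (yprod K [:: (elo e, ehi g); (elo f, ehi e); (elo g, ehi f)] * 'X_[r]).
  apply: (red_lighter mE ls) => //; [ord_neq|elen_lia|rewrite /= /inC /cell; lia|].
  by rewrite /wseq /=; minmax; rewrite /cwt; have rr := rearrange3 rfe rfg kfe kfg; clear -rr; lia.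
suff [L3 L5] : red (yprod K [:: (elo e, ehi f); (elo f, ehi g); (elo g, ehi e)] * 'X_[r]) /\
               red (yprod K [:: (elo e, ehi g); (elo f, ehi f); (elo g, ehi e)] * 'X_[r]).
  by move=> t; rewrite !inE => /or4P[|||/orP[]] /eqP->.
have [gt|lt] := ltnP (ehi e) (elo g).
  by split; apply: (red_longer erefl (leqnn _) mE ls) => //; [ord_neq | elen_lia | ord_neq| elen_lia].
have {}lt : (elo g < ehi e)%N by rewrite ltn_neqAle ntouch.
have [C|C] := boolP ((elo g <= cv n k) || (cw n k <= ehi e))%N.
  split; apply: (red_lighter mE ls) => //; try ord_neq; try elen_lia;
    try by rewrite /= /inC /cell; lia.
    by rewrite /wseq /=; minmax; rewrite /cwt; have rr := rearrange3 rfe rfg kfe kfg; clear -rr; lia.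
  by rewrite /wseq /=; minmax; rewrite /cwt; have rr := rearrange3 rfe rfg kfe kfg; clear -rr; lia.
have [e' [f' [me' mf' eE fE]]] : exists e' f', [/\ (0 < m e')%N, (0 < m f')%N,
    ehi e' = cv n k :> nat & elo f' = cw n k :> nat].
  by apply: (gap_edges n0 kE kn); lia.
have [h hE [h1 h2]] := @emon_ex _ (elo g) (ehi e) ntouch.
have le' := elo_lt e'; have lf' := elo_lt f'.
have B1 : (cv n k < elo g)%N by lia.
have B2 : (ehi e < cw n k)%N by lia.
(* The gap edges are none of [e], [f], [g], so they survive in the cofactor [r]. *)
have re' : (0 < r e')%N.
  move: me'; rewrite mE mnmDE addn_gt0 => /orP[|//] /(mseq_gt0 ls)[p].
  by rewrite !inE => /or3P[] /eqP-> [_ /=]; clear C h1 h2 ntouch; lia.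
have rf' : (0 < r f')%N.
  move: mf'; rewrite mE mnmDE addn_gt0 => /orP[|//] /(mseq_gt0 ls)[p].
  by rewrite !inE => /or3P[] /eqP-> [/= + _]; clear C h1 h2 ntouch; lia.
have D t : loopless t -> size t = 3%N -> wseq elen t = wseq elen (map ends [:: e; f; g]) ->
    (0 < mseq t h)%N -> red (yprod K t * 'X_[r]).
  move=> lt3 st wt ht; rewrite yprodE // -mpolyXD; apply: red_disjoint3.
  - by rewrite mE !(mdegD (mseq _) r) !mdeg_mseq // st.
  - by rewrite mE !(wsumD _ (mseq _) r) !wsum_mseq // wt.
  - apply/existsP; exists e'; apply/existsP; exists h; apply/existsP; exists f'.
    rewrite !mnmDE !addn_gt0 re' rf' ht !orbT /= eE fE; clear -h1 h2 lt B1 B2; lia.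
by split; apply: D => //; [ord_neq | elen_lia | rewrite /= hE !mnmDE mnm1E eqxx; lia
                         | ord_neq | elen_lia | rewrite /= hE !mnmDE mnm1E eqxx; lia].
Qed.

End SameLength.
End LongerReducible.
End Spanning.

Lemma wsum_elen_le n (m : 'X_{1..nvars n}) : (wsum elen m <= n * mdeg m)%N.
Proof.
rewrite /wsum mdegE big_distrr /=; apply: leq_sum => e _.
by rewrite mulnC leq_mul2r /elen; have := ltn_ord (ehi e); lia.
Qed.

(** Three nested inductions: on the deficit of the length from its bound [n * mdeg m], on the index
    of the pair, and on the weight for that pair. *)
Lemma spanning (K : fieldType) n (hn : (6 <= n)%N) (m : 'X_{1..nvars n}) :
  @reducible K n (@std n) 'X_[m].
Proof.
have n0 : (0 < n)%N by apply: leq_trans hn.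
have [a] := ubnP (n * mdeg m - wsum elen m); elim: a m => // a IHa m ma.
have longer (m0 : 'X_{1..nvars n}) : (n * mdeg m0 - wsum elen m0 <= a)%N ->
    forall m', mdeg m' = mdeg m0 -> (wsum elen m0 < wsum elen m')%N -> @reducible K n (@std n) 'X_[m'].
  move=> dl m' dm lm; apply: IHa; have := wsum_elen_le m'; rewrite dm.
  by lia.
have [k] := ubnP (cidx m); elim: k m ma => // k IHk m ma mk.
have [d3|nd3] := boolP (disjoint3 m).
  by apply: (red_disjoint3 hn (m := m) _ _ (leqnn _) d3) => //; apply: longer.
have := mk; have [w] := ubnP (wsum (cwt n (cidx m)) m).
elim: w m ma mk nd3 => // w IHw m ma mk nd3 mw _.
have mn := comp_exists n0 nd3; have sm := suppC_cidx mn.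
have {}longer := longer m ma.
have L2 : forall m', mdeg m' = mdeg m -> wsum elen m' = wsum elen m -> suppC (cidx m) m' ->
  (wsum (cwt n (cidx m)) m' < wsum (cwt n (cidx m)) m)%N -> @reducible K n (@std n) 'X_[m'].
  (* The pair of [m] still pierces [m'], so the index cannot rise; a drop is left to the induction
     on the pair. *)
  move=> m' dm lm sm' wm; have := cidx_le mn sm'; rewrite leq_eqVlt => /orP[/eqP E|lt].
    have [d3|nd3'] := boolP (disjoint3 m').
      by apply: (red_disjoint3 hn (m := m) longer dm _ d3); rewrite lm.
    by apply: IHw; rewrite ?dm ?lm ?E //; lia.
  by apply: IHk; rewrite ?dm ?lm //; lia.
have [S|] := boolP (stdC (cidx m) m); first by apply: reducible_std; rewrite /std mn.
rewrite negb_and !negbK => /orP[/existsP[e /existsP[f b]]|/existsP[e /existsP[f /existsP[g b]]]].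
  exact: red_badpair b.
exact: red_badtriple b.
Qed.

(** * Standard monomials are independent under [phi] *)

Section Degrees.
Variable n : nat.
Implicit Types (m a b : 'X_{1..nvars n}) (e f : 'I_(nvars n)) (w : nat -> nat -> nat).

Definition deg (i : nat) m := wsum (fun x y => (x == i) + (y == i))%N m.
Lemma degD i a b : deg i (a + b)%MM = (deg i a + deg i b)%N.
Proof. exact: wsumD. Qed.

Definition samedeg a b := forall i : 'I_n, deg i a = deg i b.

Lemma wsum_split w1 w2 m :
  wsum (fun x y => w1 x y + w2 x y)%N m = (wsum w1 m + wsum w2 m)%N.
Proof. by rewrite /wsum -big_split; apply: eq_bigr => e _; rewrite mulnDr. Qed.

Lemma eq_wsum w1 w2 m :
  (forall e, (0 < m e)%N -> w1 (elo e) (ehi e) = w2 (elo e) (ehi e)) -> wsum w1 m = wsum w2 m.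
Proof. by move=> h; apply: eq_bigr => e _; case: (posnP (m e)) => [->|/h ->]. Qed.

(** Double counting of the incidences between edges and vertices. *)
Lemma deg_wsum (f : nat -> nat) m : wsum (fun x y => f x + f y)%N m = (\sum_(i < n) deg i m * f i)%N.
Proof.
under [RHS]eq_bigr => i _ do rewrite /deg /wsum big_distrl /=.
rewrite exchange_big /=; apply: eq_bigr => e _.
under eq_bigr => i _ do rewrite -mulnA.
rewrite -big_distrr /=; congr (_ * _)%N.
under eq_bigr => i _ do rewrite mulnDl.
rewrite big_split; congr (_ + _)%N; [rewrite (bigD1 (elo e)) | rewrite (bigD1 (ehi e))] => //=;
by rewrite eqxx mul1n big1 ?addn0 // => i; rewrite -val_eqE eq_sym => /negPf /= ->.
Qed.

Lemma samedeg_wsum (f : nat -> nat) a b : samedeg a b ->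
  wsum (fun x y => f x + f y)%N a = wsum (fun x y => f x + f y)%N b.
Proof. by move=> ab; rewrite !deg_wsum; apply: eq_bigr => i _; rewrite ab. Qed.

Lemma samedeg_mdeg a b : samedeg a b -> mdeg a = mdeg b.
Proof.
move=> /(samedeg_wsum (fun=> 1%N)); rewrite /wsum !mdegE -!big_distrl /=.
by move/eqP; rewrite eqn_pmul2r // => /eqP.
Qed.

Definition stmon a b : 'X_{1..n + n} :=
  [multinom match split i with inl j => deg j a | inr j => deg j b end | i < n + n].

Lemma stmonP a b a' b' : stmon a b = stmon a' b' -> samedeg a a' /\ samedeg b b'.
Proof.
move=> /mnmP h; split=> i.
  by have := h (lshift n i); rewrite !mnmE (unsplitK (inl _ i)).
by have := h (rshift n i); rewrite !mnmE (unsplitK (inr _ i)).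
Qed.

Lemma stmonD a b a' b' : stmon (a + a') (b + b') = (stmon a b + stmon a' b')%MM.
Proof. by apply/mnmP => i; rewrite !mnmE; case: split => j; rewrite degD. Qed.

Lemma stmon0 : stmon 0%MM 0%MM = 0%MM.
Proof. by apply/mnmP => i; rewrite !mnmE; case: split => j; rewrite /deg wsum0. Qed.

Lemma mnm_ind (P : 'X_{1..nvars n} -> Prop) :
  P 0%MM -> (forall e m, P m -> P (U_(e) + m)%MM) -> forall m, P m.
Proof.
move=> P0 PS m; have [d] := ubnP (mdeg m); elim: d m => // d IH m md.
have [->//|] := eqVneq m 0%MM; rewrite -mdeg_eq0 mdegE sum_nat_eq0 negb_forall => /existsP[e /= me].
have eE : m = (U_(e) + (m - U_(e)))%MM.
  by rewrite mpoly.addmC submK //; apply/mnm_lepP => f; rewrite mnm1E; case: eqP => // <-; rewrite lt0n.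
by rewrite eE; apply/PS/IH; move: md; rewrite [in mdeg m]eE mdegD mdeg1.
Qed.

Variable K : fieldType.

Lemma phi_edge e : phi ('X_[U_(e)] : {mpoly K[nvars n]}) = 'X_[stmon U_(e) 0] + 'X_[stmon 0 U_(e)].
Proof.
rewrite -[in LHS]emon_edge -(yyE K) ?phi_yy -?val_eqE ?neq_ltn ?elo_lt ?orbT //.
rewrite /svar /tvar -!mpolyXD; congr ('X_[_] + 'X_[_]); apply/mnmP => i; rewrite !mnmE.
  case: splitP => j ij; rewrite /deg ?wsum0 ?wsum1 -!val_eqE /= ?ij; first lia.
  by have := ltn_ord (elo e); have := ltn_ord (ehi e); lia.
case: splitP => j ij; rewrite /deg ?wsum0 ?wsum1 -!val_eqE /= ?ij; last lia.
by have := ltn_ord j; lia.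
Qed.

Lemma phiXD m1 m2 : phi ('X_[m1 + m2] : {mpoly K[nvars n]}) = phi 'X_[m1] * phi 'X_[m2].
Proof. by rewrite mpolyXD rmorphM. Qed.

Lemma phi_supp m x : x \in msupp (phi ('X_[m] : {mpoly K[nvars n]})) ->
  exists a b, m = (a + b)%MM /\ x = stmon a b.
Proof.
elim/mnm_ind: m x => [x|e m IH x].
  rewrite mpolyX0 rmorph1 msupp1 inE => /eqP->; exists 0%MM, 0%MM; split; last by rewrite stmon0.
  by rewrite addm0.
rewrite phiXD phi_edge mulrDl => /msuppD_le; rewrite mem_cat mulrC [X in _ || (x \in msupp X)]mulrC.
case/orP; rewrite (perm_mem (msuppMX _ _)) => /mapP[z /IH[a [b [-> ->]]] ->].
  by exists (U_(e) + a)%MM, b; rewrite addmA -stmonD add0m.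
by exists a, (U_(e) + b)%MM; rewrite addmA [(U_(e) + a)%MM]mpoly.addmC -addmA -stmonD add0m.
Qed.

Lemma mcoeffMX_eq0 (p : {mpoly K[n + n]}) (u x : 'X_{1..n + n}) :
  (forall z, z \in msupp p -> x = (u + z)%MM -> False) -> ('X_[u] * p)@_x = 0.
Proof.
move=> h; apply/eqP; rewrite mcoeff_eq0 mulrC (perm_mem (msuppMX _ _)).
by apply/negP => /mapP[z zp /(h z zp)].
Qed.

Lemma mcoeffXM (p : {mpoly K[n + n]}) (u z : 'X_{1..n + n}) : ('X_[u] * p)@_(u + z) = p@_z.
Proof. by rewrite mulrC mcoeffMX. Qed.

Lemma phi_coef0 m : (phi ('X_[m] : {mpoly K[nvars n]}))@_(stmon 0 m) = 1.
Proof.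
elim/mnm_ind: m => [|e m IH]; first by rewrite mpolyX0 rmorph1 stmon0 mcoeff1 eqxx.
rewrite phiXD phi_edge mulrDl mcoeffD mcoeffMX_eq0 ?add0r.
  by rewrite -[X in stmon X _](addm0 0%MM) stmonD mcoeffXM.
move=> z /phi_supp[a [b [_ ->]]]; rewrite -stmonD => /stmonP[/samedeg_mdeg + _].
by rewrite mdegD mdeg1 mdeg0.
Qed.

(** The first hypothesis gives all copies of an edge the same colour, so no binomial coefficient
    that might vanish in [K] appears; the second leaves a single colouring. *)
Lemma phi_coef m1 m2 : (forall e, m1 e = 0%N \/ m2 e = 0%N) ->
  (forall a b, (a + b = m1 + m2)%MM -> samedeg a m1 -> samedeg b m2 -> a = m1) ->
  (phi ('X_[m1 + m2] : {mpoly K[nvars n]}))@_(stmon m1 m2) = 1.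
Proof.
elim/mnm_ind: m1 => [|e m1 IH] disj uniq; first by rewrite add0m phi_coef0.
rewrite -addmA phiXD phi_edge mulrDl mcoeffD [X in _ + X]mcoeffMX_eq0 ?addr0.
  rewrite -[X in stmon _ X]add0m stmonD mcoeffXM; apply: IH => [f|a b ab h1 h2].
    by have [/eqP|->] := disj f; [rewrite mnmDE addn_eq0 => /andP[_ /eqP]; left | right].
  apply: (@mpoly.addmI _ U_(e)%MM).
  by apply: (uniq _ b) => // [|i]; rewrite -?addmA ?ab // !degD h1.
(* Giving this copy of [e] the second colour would, by uniqueness, put [e] into [m2], against
   [disj]. *)
move=> z /phi_supp[a [b [ab ->]]]; rewrite -stmonD add0m => /stmonP[h1 h2].
have E : a = (U_(e) + m1)%MM.
  apply: (uniq a (U_(e) + b)%MM) => //.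
  by rewrite addmA [(a + _)%MM]mpoly.addmC -!addmA ab.
have [|m2e] := disj e; first by rewrite mnmDE mnm1E eqxx.
have : m2 = (U_(e) + b)%MM.
  by apply: (@mpoly.addmI _ (U_(e) + m1)%MM); rewrite -[LHS]addmA ab addmA [(U_(e) + a)%MM]mpoly.addmC E -addmA.
by move/mnmP/(_ e); rewrite m2e mnmDE mnm1E eqxx.
Qed.
End Degrees.

(** * Monomials in one cell, and antichains *)

Section Cells.
Variable n : nat.
Implicit Types (m a b : 'X_{1..nvars n}) (e f : 'I_(nvars n)) (v k r c : nat).

Definition incell v m := forall e, (0 < m e)%N -> cell v (elo e) (ehi e).

Definition dist (i j : nat) := (i - j + (j - i))%N.

(** [|x - y| <= |x - v| + |y - v|], with equality when [v] lies between [x] and [y], and the total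
    of the right sides depends only on the degrees. *)
Lemma incell_samedeg v m a : incell v m -> samedeg a m -> (wsum elen a <= wsum elen m)%N.
Proof.
move=> mv am; have -> : wsum elen m = wsum (fun x y => dist x v + dist y v)%N m.
  by apply: eq_wsum => e /mv; rewrite /cell /dist /elen; lia.
rewrite -(samedeg_wsum (dist^~ v) am); apply: leq_sum => e _.
by rewrite leq_mul2l; apply/orP; right; rewrite /elen /dist; lia.
Qed.

Lemma incell_eq_len v m a : incell v m -> samedeg a m -> wsum elen a = wsum elen m -> incell v a.
Proof.
move=> mv am; have -> : wsum elen m = wsum (fun x y => dist x v + dist y v)%N m.
  by apply: eq_wsum => e /mv; rewrite /cell /dist /elen; lia.
rewrite -(samedeg_wsum (dist^~ v) am) => E e ae.
have [//|ce] := boolP (cell v (elo e) (ehi e)).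
suff : (wsum elen a < wsum (fun x y => dist x v + dist y v)%N a)%N by rewrite E ltnn.
rewrite /wsum (bigD1 e) //= [X in (_ < X)%N](bigD1 e) //= -addSn leq_add //.
  by rewrite ltn_pmul2l //; move: ce (elo_lt e); rewrite /cell /elen /dist; lia.
by apply: leq_sum => f _; rewrite leq_mul2l; apply/orP; right; rewrite /elen /dist; lia.
Qed.

(* In the cell of [v] an end is lower or upper according to its side of [v], so the
   degrees also determine how many edges have lower (resp. upper) end [v]. *)
Lemma incell_bipartite v m a (al be : nat -> nat) : incell v m -> incell v a -> samedeg a m ->
  wsum (fun x y => al x + be y)%N a = wsum (fun x y => al x + be y)%N m.
Proof.
move=> mv av am.
pose f i := ((if (i < v)%N then al v else 0) + (if (v < i)%N then be v else 0))%N.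
pose p i := ((if (i < v)%N then al i else 0) + (if (v < i)%N then be i else 0))%N.
have E b : incell v b -> (wsum (fun x y => al x + be y) b + wsum (fun x y => f x + f y) b =
   wsum (fun x y => p x + p y) b + mdeg b * (al v + be v))%N.
  move=> bv; rewrite -wsum_split mdegE big_distrl -big_split /=; apply: eq_bigr => e _.
  rewrite -mulnDr; case: (posnP (b e)) => [->//|/bv h]; congr (_ * _)%N.
  move: h (elo_lt e); rewrite /f /p /cell.
  case: (ltngtP (elo e) v) => h1; case: (ltngtP (ehi e) v) => h2; rewrite ?h1 ?h2; lia.
have := E _ av; have := E _ mv.
by rewrite (samedeg_wsum f am) (samedeg_wsum p am) (samedeg_mdeg am); lia.
Qed.

(** Quadrant counts refine the weight: they sum to it, they determine the monomial, and an antichain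
    minimizes each of them among the monomials of its cell with its degrees. *)
Definition quad k r c (x y : nat) : nat := (r < rho n k x)%N && (c < kap n k y)%N.

Lemma antichain_quad v k r c m a : incell v m -> incell v a -> samedeg a m ->
  (forall e f, (0 < m e)%N -> (0 < m f)%N -> ~~ ltC k e f) ->
  (wsum (quad k r c) m <= wsum (quad k r c) a)%N.
Proof.
move=> mv av am anti.
pose R x : nat := (r < rho n k x)%N; pose C y : nat := (c < kap n k y)%N.
(* In an antichain one of the opposite quadrants [quad], [quad'] is empty, while by [E]
   the difference of their counts only depends on the degrees. *)
pose quad' x y : nat := (rho n k x <= r)%N && (kap n k y <= c)%N.
have E b : (wsum (quad k r c) b + mdeg b = wsum quad' b + wsum (fun x y => R x + C y) b)%N.
  rewrite -wsum_split mdegE -big_split /=; apply: eq_bigr => e _.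
  by rewrite -[X in (_ + X)%N]muln1 -mulnDr /quad /quad' /R /C; lia.
have Z (w : nat -> nat -> nat) b : (forall e, (0 < b e)%N -> w (elo e) (ehi e) = 0%N) -> wsum w b = 0%N.
  by move=> h; rewrite /wsum big1 // => e _; case: (posnP (b e)) => [->//|/h ->]; rewrite ?muln0.
have [/existsP[e /andP[me qe]]|/existsPn noq] := boolP [exists e, (0 < m e)%N && (quad k r c (elo e) (ehi e) == 1%N)].
  have := E m; have := E a; rewrite (incell_bipartite R C mv av am) (samedeg_mdeg am).
  rewrite (Z quad' m); first by lia.
  by move=> f mf; have := anti f e mf me; move: qe; rewrite /quad /quad' /ltC; lia.
rewrite Z // => e me; have := noq e; rewrite me /= /quad; lia.
Qed.

Lemma rhokap_inj k e f : rho n k (elo e) = rho n k (elo f) -> kap n k (ehi e) = kap n k (ehi f) -> e = f.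
Proof.
move=> h1 h2; apply: edge_inj; apply: val_inj.
  by move: h1; rewrite /rho /=; case: eqP; case: eqP; lia.
have := ltn_ord (ehi e); have := ltn_ord (ehi f).
by move: h2; rewrite /kap /=; case: eqP; case: eqP; lia.
Qed.

(** Inclusion-exclusion on four quadrants isolates one edge. As [rho] and [kap] are at most [n + 1]
    on the ends of edges, indices below [n.+2] suffice. *)
Lemma quad_inj k a b : (forall r c, (r < n.+2)%N -> (c < n.+2)%N -> wsum (quad k r c) a = wsum (quad k r c) b) -> a = b.
Proof.
move=> h; apply/mnmP => e.
have [r rE] : exists r, rho n k (elo e) = r.+1 by rewrite /rho; case: eqP; eexists.
have [c cE] : exists c, kap n k (ehi e) = c.+1 by rewrite /kap; case: eqP; eexists.
have rn : (r.+1 < n.+2)%N by move: rE; rewrite /rho; case: eqP; have := ltn_ord (elo e); lia.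
have cn : (c.+1 < n.+2)%N by move: cE; rewrite /kap; case: eqP; have := ltn_ord (ehi e); lia.
have E m : (m e + wsum (quad k r.+1 c) m + wsum (quad k r c.+1) m =
            wsum (quad k r c) m + wsum (quad k r.+1 c.+1) m)%N.
  have -> : m e = wsum (fun x y => (rho n k x == r.+1) && (kap n k y == c.+1) : nat) m.
    rewrite /wsum (bigD1 e) //= rE cE !eqxx muln1 big1 ?addn0 // => f fe.
    case: eqP => //; case: eqP; rewrite ?muln0 // => h2 h1.
    by case/eqP: fe; apply: (@rhokap_inj k); rewrite ?rE ?cE.
  rewrite -!wsum_split; apply: eq_wsum => f _; rewrite /quad; lia.
have := E a; have := E b; rewrite !h //; lia.
Qed.

Lemma wsum_cwt k m : wsum (cwt n k) m = (\sum_(r < n.+2) \sum_(c < n.+2) wsum (quad k r c) m)%N.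
Proof.
under eq_bigr => r _ do rewrite exchange_big /=.
rewrite exchange_big /=; apply: eq_bigr => e _.
under eq_bigr => r _ do rewrite -big_distrr /=.
rewrite -big_distrr /=; congr (_ * _)%N.
have S N x : (\sum_(r < N) (r < x))%N = minn N x.
  by elim: N => [|N IH]; rewrite ?big_ord0 ?min0n // big_ord_recr /= IH; lia.
transitivity ((\sum_(r < n.+2) (r < rho n k (elo e))) * (\sum_(c < n.+2) (c < kap n k (ehi e))))%N.
  rewrite !S; congr (_ * _)%N; [rewrite /rho | rewrite /kap]; case: eqP.
  - by have := ltn_ord (elo e); lia.
  - by have := ltn_ord (elo e); lia.
  - by have := ltn_ord (ehi e); lia.
  - by have := ltn_ord (ehi e); lia.
rewrite big_distrl /=; apply: eq_bigr => r _; rewrite big_distrr /=; apply: eq_bigr => c _.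
by rewrite /quad mulnb.
Qed.
End Cells.

(** * The canonical colouring of a standard monomial *)

Section Colouring.
Variable n : nat.
Implicit Types (m a b : 'X_{1..nvars n}) (e f g : 'I_(nvars n)) (k r c : nat).

(** An edge in both cells takes the first colour exactly when nothing in the support of [m] lies
    below it; so a two-step chain with both edges of one colour forces a bad pair or triple. *)
Definition scol k m e := onlyv k e || both k e && ~~ [exists f, (0 < m f)%N && ltC k f e].
Definition spart k m : 'X_{1..nvars n} := [multinom if scol k m e then m e else 0%N | e < nvars n].
Definition tpart k m : 'X_{1..nvars n} := [multinom if scol k m e then 0%N else m e | e < nvars n].

Lemma spart_tpart k m : (spart k m + tpart k m)%MM = m.
Proof. by apply/mnmP => e; rewrite !mnmE; case: scol; rewrite ?addn0. Qed.

Lemma spart_gt0 k m e : (0 < spart k m e)%N -> (0 < m e)%N /\ scol k m e.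
Proof. by rewrite mnmE; case: scol. Qed.

Lemma tpart_gt0 k m e : (0 < tpart k m e)%N -> (0 < m e)%N /\ ~~ scol k m e.
Proof. by rewrite mnmE; case: scol. Qed.

Lemma spart_incell k m : suppC k m -> incell (cv n k) (spart k m).
Proof.
move=> sm e /spart_gt0[/(suppCP sm) + ]; rewrite /inC /scol /onlyv /both.
by case: cell => //; case: cell.
Qed.

Lemma tpart_incell k m : suppC k m -> incell (cw n k) (tpart k m).
Proof.
by move=> sm e /tpart_gt0[_]; rewrite /scol negb_or /onlyv negbK => /andP[].
Qed.

(** If [e] lies below [f], then [f] is not minimal, so it avoids the cell of [w]; by the order of
    upper ends so does [e], and they form a bad pair. *)
Lemma spart_antichain k m e f : suppC k m -> stdC k m ->
  (0 < spart k m e)%N -> (0 < spart k m f)%N -> ~~ ltC k e f.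
Proof.
move=> sm /andP[np _] /spart_gt0[me se] /spart_gt0[mf sf]; apply/negP => ef.
have of_ : onlyv k f.
  case/orP: sf => // /andP[_ /existsP[]]; by exists e; rewrite me ef.
have oe : onlyv k e.
  case/orP: se => // /andP[be _]; have := ltn_ord (ehi f); move: be of_ ef (suppCP sm mf) (elo_lt e) (elo_lt f) (cvw n k).
  by rewrite /both /onlyv /inC /ltC /cell /rho /kap; do 4!case: eqP; lia.
by case/existsP: np; exists e; apply/existsP; exists f; rewrite /badpair me mf ef oe of_.
Qed.

(** If the lower edge [e] is in both cells, something lies below it and completes a bad triple;
    otherwise both edges avoid the cell of [v] and form a bad pair. *)
Lemma tpart_antichain k m e f : suppC k m -> stdC k m ->
  (0 < tpart k m e)%N -> (0 < tpart k m f)%N -> ~~ ltC k e f.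
Proof.
move=> sm /andP[np nt] /tpart_gt0[me se] /tpart_gt0[mf sf]; apply/negP => ef.
have [be|nbe] := boolP (both k e).
  move: se; rewrite /scol be negb_or negbK => /andP[_ /existsP[g /andP[mg ge]]].
  by case/existsP: nt; exists g; apply/existsP; exists e; apply/existsP; exists f; rewrite /badtriple mg me mf ge ef be.
have oe : onlyw k e.
  by move: se nbe; rewrite /scol /onlyv /onlyw /both; case: cell; case: cell.
have of_ : onlyw k f.
  move: sf oe ef (suppCP sm me) (elo_lt e) (elo_lt f) (cvw n k).
  rewrite /scol negb_or => /andP[+ _].
  by rewrite /onlyw /onlyv /inC /ltC /cell /rho /kap; do 4!case: eqP; lia.
by case/existsP: np; exists e; apply/existsP; exists f; rewrite /badpair me mf ef oe of_ orbT.
Qed.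

Lemma leq_sum_eq (I : finType) (F G : I -> nat) : (forall i, F i <= G i)%N ->
  (\sum_i G i <= \sum_i F i)%N -> forall i, F i = G i.
Proof.
move=> FG GF i; apply/eqP; rewrite eqn_leq FG /= leqNgt; apply/negP => lt.
suff : (\sum_i F i < \sum_i G i)%N by rewrite ltnNge GF.
by rewrite (bigD1 i) //= [X in (_ < X)%N](bigD1 i) //= -addSn leq_add // leq_sum.
Qed.

(** The length bound leaves only equality, which puts [a] and [b] into their cells. There the
    antichains minimize every quadrant count, so the weight bound makes all counts equal, and
    [quad_inj] concludes. *)
Lemma colouring_rigid k m a b : suppC k m -> stdC k m ->
  samedeg a (spart k m) -> samedeg b (tpart k m) -> (wsum elen m <= wsum elen (a + b)%MM)%N ->
  (suppC k (a + b)%MM -> wsum elen (a + b)%MM = wsum elen m ->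
    (wsum (cwt n k) (a + b)%MM <= wsum (cwt n k) m)%N) ->
  a = spart k m /\ b = tpart k m.
Proof.
move=> sm std am bm; have [vs wt] := (spart_incell sm, tpart_incell sm).
have la := incell_samedeg vs am; have lb := incell_samedeg wt bm.
have wE w : wsum w m = (wsum w (spart k m) + wsum w (tpart k m))%N by rewrite -wsumD spart_tpart.
rewrite !wE !wsumD => lab.
have ca : incell (cv n k) a by apply: incell_eq_len vs am _; lia.
have cb : incell (cw n k) b by apply: incell_eq_len wt bm _; lia.
have sab : suppC k (a + b)%MM.
  apply/forallP => e; apply/implyP; rewrite mnmDE addn_gt0 /inC => /orP[/ca ->//|/cb ->].
  by rewrite orbT.
move=> /(_ sab); rewrite !wsum_cwt => W; have {}W := W (_ : _ = _).
have Qa r c := antichain_quad r c vs ca am (fun e f => spart_antichain (e := e) (f := f) sm std).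
have Qb r c := antichain_quad r c wt cb bm (fun e f => tpart_antichain (e := e) (f := f) sm std).
have EW : (\sum_(p : 'I_n.+2 * 'I_n.+2) (wsum (quad n k p.1 p.2) a + wsum (quad n k p.1 p.2) b) <=
  \sum_(p : 'I_n.+2 * 'I_n.+2)
     (wsum (quad n k p.1 p.2) (spart k m) + wsum (quad n k p.1 p.2) (tpart k m)))%N.
  rewrite !big_split /= -!(pair_bigA _ (fun r c : 'I_n.+2 => wsum (quad n k r c) _)) /=.
  by apply: W; lia.
have E := leq_sum_eq (fun p : 'I_n.+2 * 'I_n.+2 => leq_add (Qa p.1 p.2) (Qb p.1 p.2)) EW.
by split; apply: (@quad_inj _ k) => r c rn cn; have := E (Ordinal rn, Ordinal cn);
  have := Qa r c; have := Qb r c => /=; lia.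
Qed.

End Colouring.

(** * Leading terms and the conclusion *)

Lemma seq_min (T : eqType) (r : rel T) (s : seq T) : total r -> transitive r -> s != [::] ->
  exists2 x, x \in s & {in s, forall y, r x y}.
Proof.
move=> tot tr; elim: s => // x [|y s] IH _.
  by exists x => [|z]; rewrite inE // => /eqP->; have := tot x x; rewrite orbb.
have [z zs zmin] := IH isT; case/orP: (tot x z) => xz.
  exists x; first exact: mem_head.
  by move=> u; rewrite inE => /predU1P[->|/zmin]; [have := tot x x; rewrite orbb | apply: tr].
by exists z => [|u]; rewrite inE ?zs ?orbT // => /predU1P[->|/zmin].
Qed.

Lemma std_independent (K : fieldType) n (n0 : (0 < n)%N) (h : {mpoly K[nvars n]}) :
  (forall m, m \in msupp h -> @std n m) -> phi h = 0 -> h = 0.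
Proof.
move=> hstd ph; apply/eqP; rewrite -msupp_eq0; apply: contraT => nz.
pose W m := wsum (cwt n (@cidx n m)) m.
(* The weight is compared in reverse, so that the heaviest monomial comes first. *)
pose r m m' := (wsum elen m < wsum elen m')%N || ((wsum elen m == wsum elen m') &&
  ((cidx m < cidx m')%N || ((cidx m == cidx m') && (W m' <= W m)%N))).
have [||m mh mmin] := @seq_min _ r _ _ _ nz.
- by move=> x y; rewrite /r; lia.
- by move=> y x z; rewrite /r; lia.
have /andP[mk sm] := hstd m mh; have sC := suppC_cidx mk; set k := cidx m in mk sm sC.
have R m' a b : m' \in msupp h -> m' = (a + b)%MM -> samedeg a (spart k m) ->
    samedeg b (tpart k m) -> a = spart k m /\ b = tpart k m.
  move=> m'h E am bm; have := mmin m' m'h; rewrite /r E => rm.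
  apply: (colouring_rigid sC sm am bm) => [|sab lab]; first by lia.
  have km := cidx_le mk sab; move: rm; rewrite lab ltnn eqxx /= /W -/k.
  by case/orP => [|/andP[/eqP <-]//]; lia.
(* By [R] no other monomial of [h] contributes to this coefficient, and [m] contributes with factor
   1 by [phi_coef]. *)
suff : (phi h)@_(stmon (spart k m) (tpart k m)) = h@_m.
  by rewrite ph mcoeff0 => /esym/eqP; rewrite mcoeff_eq0 mh.
rewrite [in LHS](mpolyE h) rmorph_sum raddf_sum /= (bigD1_seq m) //= big1_seq => [|m' /andP[m'm m'h]].
  rewrite addr0 /phi comp_mpolyZ -/(phi _) mcoeffZ -[X in phi 'X_[X]](spart_tpart k m) phi_coef ?mulr1 //.
    by move=> e; rewrite !mnmE; case: scol; [right|left].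
  by move=> a b; rewrite spart_tpart => /esym E am bm; case: (R m a b mh E am bm).
rewrite /phi comp_mpolyZ -/(phi _) mcoeffZ.
apply/eqP; rewrite mulf_eq0; apply/orP; right; rewrite mcoeff_eq0; apply/negP => /phi_supp[a [b [E /esym/stmonP[am bm]]]].
have [Ea Eb] := R m' a b m'h E am bm.
by case/eqP: m'm; rewrite E Ea Eb spart_tpart.
Qed.

Theorem theorem1p7 (K : fieldType) (n : nat) (hn : (6 <= n)%N) :
  forall p : {mpoly K[nvars n]},
    In_ideal p <-> in_ideal_gen (@gens K n) p.
Proof.
move=> p; have n0 : (0 < n)%N by apply: leq_trans hn.
split=> [pp|]; last exact: phi_ideal.
have [g Jg hstd] : @reducible K n (@std n) p.
  rewrite (mpolyE p); apply: reducible_sum => m.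
  exact/reducibleZ/spanning.
suff /eqP : p - g = 0 by rewrite subr_eq0 => /eqP->.
apply: std_independent => //; rewrite rmorphB /= (phi_ideal hn Jg) subr0.
exact: pp.
Qed.
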